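(* Let $d \ge 1$, and for $0<r<1$ let $\beta_r(\cdot)$ be the annealed Lyapunov exponent of the simple random walk on $\mathbb{Z}^d$ in the Bernoulli potential with parameter $r$. Then the following hold. (1) For all $0<p<q<1$, $$\inf_{x \in \mathbb{R}^d\setminus\{0\}}\frac{\beta_p(x)-\beta_q(x)}{\|x\|_1} \ge (1-e^{-1})(q-p).$$ (2) Let $0<q_0<1$. Then there exists a constant $0<C<\infty$ (which may depend on $d$ and $q_0$) such that for all $0<p<q\le q_0$, $$\sup_{x \in \mathbb{R}^d\setminus\{0\}}\frac{\beta_p(x)-\beta_q(x)}{\|x\|_1} \le C(\log q-\log p).$$ In particular, if $d\ge3$, then the right side can be replaced by $C(q-p)$, i.e. there exists a constant $0<C<\infty$ (which may depend on $d$ and $q_0$) such that for all $0<p<q\le q_0$ the supremum above is at most $C(q-p)$.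
   Context: $(S_k)_{k\ge0}$ is the simple (symmetric nearest-neighbor) random walk on $\mathbb{Z}^d$; $P^x$, $E^x$ are its law and expectation when started at $x$. $H(y):=\inf\{k\ge 0: S_k=y\}$. For a potential $\omega=(\omega(x))_{x\in\mathbb{Z}^d}\in[0,\infty)^{\mathbb{Z}^d}$, define $$e(x,y,\omega):=E^x\Bigl[\exp\Bigl\{-\sum_{k=0}^{H(y)-1}\omega(S_k)\Bigr\}\mathbf{1}_{\{H(y)<\infty\}}\Bigr]$$ (with $e(x,x,\omega)=1$). For $0\le r\le 1$, $\mathbb{P}_r$ (expectation $\mathbb{E}_r$) is the law, independent of the walk, under which the $\omega(x)$, $x\in\mathbb{Z}^d$, are i.i.d. with $\mathbb{P}_r(\omega(x)=0)=1-\mathbb{P}_r(\omega(x)=1)=r$; then $\omega$ is called the Bernoulli potential with parameter $r$. The annealed travel cost is $b_r(x,y):=-\log\mathbb{E}_r[e(x,y,\omega)]$. The annealed Lyapunov exponent $\beta_r(\cdot)$ is the norm on $\mathbb{R}^d$ determined by $\beta_r(x)=\lim_{n\to\infty}\frac1n b_r(0,nx)=\inf_{n\in\mathbb{N}}\frac1n b_r(0,nx)$ for all $x\in\mathbb{Z}^d$ (it is known that such a norm exists). $\|\cdot\|_1$ is the $\ell^1$-norm on $\mathbb{R}^d$. *)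

(* Defs.v *)
From HB Require Import structures.
From mathcomp Require Import all_boot all_order all_algebra.
From mathcomp Require Import all_classical all_reals all_analysis.

Set Implicit Arguments.
Unset Strict Implicit.
Unset Printing Implicit Defensive.

Import Order.TTheory GRing.Theory Num.Theory.
Import numFieldNormedType.Exports.

Local Open Scope classical_set_scope.
Local Open Scope ring_scope.

(** The lattice Z^d is ['rV[int]_d] and R^d is ['rV[R]_d]. *)

Definition l1norm (K : numDomainType) (d : nat) (v : 'rV[K]_d) : K :=
  \sum_(i < d) `|v ord0 i|.

Definition embed (R : realType) (d : nat) (x : 'rV[int]_d) : 'rV[R]_d :=
  map_mx (fun m : int => m%:~R) x.

(** Mutual independence of a family of random variables with values in [V]
    equipped with the sigma-algebra [F]. *)
Definition mutually_independent (dT : measure_display) (T : measurableType dT)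
    (R : realType) (P : probability T R) (I : eqType) (V : Type)
    (F : set (set V)) (X : I -> T -> V) : Prop :=
  forall (J : seq I) (A : I -> set V), uniq J -> (forall i, F (A i)) ->
    P (\bigcap_(i in [set` J]) (X i @^-1` A i)) =
    (\prod_(i <- J) P (X i @^-1` A i))%E.

(** The law P^x of the simple random walk started at [x]: the steps are i.i.d.
    and uniform on the 2d lattice vectors of l1-norm 1. *)
Definition is_srw_law (R : realType) (d : nat) (dW : measure_display)
    (W : measurableType dW) (P : probability W R) (x : 'rV[int]_d)
    (S : nat -> W -> 'rV[int]_d) : Prop :=
  let step k w := S k.+1 w - S k w in
  [/\ P (S 0%N @^-1` [set x]) = 1%E,
      forall k v, P (step k @^-1` [set v]) =
        (if l1norm v == 1 then (2 * d%:R)^-1 else 0)%:E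
    & mutually_independent P discrete_measurable step].

(** The walk is realized as one process under a family of laws P^x. *)
Record simple_random_walk (R : realType) (d : nat) := SimpleRandomWalk {
  walk_disp : measure_display;
  walk_space : measurableType walk_disp;
  walk_law : 'rV[int]_d -> probability walk_space R;
  walk_pos : nat -> walk_space -> 'rV[int]_d;
  walk_measurable : forall k (A : set 'rV[int]_d),
    measurable (walk_pos k @^-1` A);
  walk_srw : forall x, is_srw_law (walk_law x) x walk_pos
}.

Definition is_bernoulli_law (R : realType) (d : nat) (dO : measure_display)
    (O : measurableType dO) (P : probability O R) (r : R)
    (omega : 'rV[int]_d -> O -> R) : Prop :=
  [/\ forall z, P (omega z @^-1` [set 0]) = r%:E,
      forall z, P (omega z @^-1` [set 1]) = (1 - r)%:E
    & mutually_independent P (@measurable _ R) omega].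

(** The potential is one random field under a family of laws P_r. *)
Record bernoulli_potential (R : realType) (d : nat) := BernoulliPotential {
  pot_disp : measure_display;
  pot_space : measurableType pot_disp;
  pot_law : R -> probability pot_space R;
  pot_val : 'rV[int]_d -> {mfun pot_space >-> R};
  pot_ge0 : forall z o, 0 <= pot_val z o;
  pot_bernoulli : forall r : R, 0 <= r <= 1 ->
    is_bernoulli_law (pot_law r) r pot_val
}.

Arguments walk_law {R d} s _.
Arguments walk_pos {R d} s _ _.
Arguments pot_law {R d} b _.
Arguments pot_val {R d} b _.

(** H(y), with [None] standing for +oo. *)
Definition hitting_time (d : nat) (s : nat -> 'rV[int]_d) (y : 'rV[int]_d) :
    option nat :=
  match pselect (exists k, s k == y) with
  | left h => Some (ex_minn h)
  | right _ => None
  end.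

Definition path_weight (R : realType) (d : nat) (omega : 'rV[int]_d -> R)
    (s : nat -> 'rV[int]_d) (y : 'rV[int]_d) : R :=
  if hitting_time s y is Some h then expR (- \sum_(k < h) omega (s k)) else 0.

Section AnnealedLyapunov.
Context (R : realType) (d : nat).
Variables (walk : simple_random_walk R d) (pot : bernoulli_potential R d).

(** e(x, y, omega) *)
Definition travel_weight (x y : 'rV[int]_d) (omega : 'rV[int]_d -> R) : R :=
  fine ('E_(walk_law walk x)[fun w => path_weight omega (walk_pos walk ^~ w) y])%E.

(** b_r(x, y); for 0 < r < 1 the expectation lies in ]0, 1], so that [fine] and
    [ln] are harmless. *)
Definition annealed_cost (r : R) (x y : 'rV[int]_d) : R :=
  - ln (fine ('E_(pot_law pot r)[fun o =>
      travel_weight x y (fun z => pot_val pot z o)])%E).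

Definition is_norm (N : 'rV[R]_d -> R) : Prop :=
  [/\ forall u v, N (u + v) <= N u + N v,
      forall (a : R) u, N (a *: u) = `|a| * N u
    & forall u, N u = 0 -> u = 0].

(** [beta] is the norm beta_r; it is unique, since a norm on R^d is determined
    by its values on Z^d. *)
Definition annealed_lyapunov (r : R) (beta : 'rV[R]_d -> R) : Prop :=
  [/\ is_norm beta,
      forall x : 'rV[int]_d,
        (fun n : nat => annealed_cost r 0 (x *+ n) / n%:R) @ \oo
          --> beta (embed R x)
    & forall x : 'rV[int]_d, beta (embed R x) =
        inf [set annealed_cost r 0 (x *+ n) / n%:R | n in [set n | (0 < n)%N]]].

End AnnealedLyapunov.

Definition slope_set (R : realType) (d : nat) (f g : 'rV[R]_d -> R) :
    set (\bar R) :=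
  [set ((f x - g x) / l1norm x)%:E | x in [set x : 'rV[R]_d | x != 0]].

(* Main.v *)
Require Import Defs.
From HB Require Import structures.
From mathcomp Require Import all_boot all_order all_algebra.
From mathcomp Require Import all_classical all_reals all_analysis.
From mathcomp Require Import measurable_realfun.
From mathcomp Require Import zify ring lra.

Set Implicit Arguments.
Unset Strict Implicit.
Unset Printing Implicit Defensive.

Import Order.TTheory GRing.Theory Num.Theory.
Import numFieldNormedType.Exports.

Local Open Scope classical_set_scope.
Local Open Scope ring_scope.

(** Averaging over the potential turns exp(- b_r(0, y)) into the partition
    function Z_r(y), the sum over first-passage paths t from 0 to y of
    (2d)^(-|t|) times the product of r + (1 - r) e^(-l) over the visited sites,
    l being the number of visits.

    (1) A path to y visits at least |y|_1 sites, and going from q down to p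
    multiplies the factor of each of them by at most exp(- (1 - e^(-1)) (q - p)).

    (2) By Jensen's inequality under the path measure of Z_q, it suffices to
    bound the mean of the sum over visited sites of the log-ratio of the factors.
    The ratio is at most q / p, and the mean number of visited sites is O(|y|_1)
    because each site costs a factor bounded away from 1 whereas Z_q decays at
    most exponentially in |y|_1. If d >= 3 and q <= 2p the log-ratio is at most
    2 (q - p) divided by the factor for q. Erasing the loops at a site z does not
    decrease the factors of the other sites and the loops have total mass
    rho < 1 by transience, so that the mean of the inverse factors is at most
    e / (1 - rho) times the mean number of visited sites. General p < q are
    joined by doubling.

    Both bounds pass to the limit along n x, and then from Z^d to R^d by
    homogeneity and continuity of norms. *)

(** * First-passage paths on the lattice *)

Section Lattice.
Context (d : nat).
Implicit Types (x y z u v : 'rV[int]_d) (t : seq 'rV[int]_d).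

Definition sitenorm x : nat := \sum_(i < d) `|x ord0 i|%N.

Lemma l1norm_int x : l1norm x = (sitenorm x)%:Z.
Proof.
rewrite /l1norm /sitenorm (big_morph Posz PoszD (erefl _)).
by apply: eq_bigr => i _; rewrite abszE.
Qed.

Lemma sitenormD x y : (sitenorm (x + y) <= sitenorm x + sitenorm y)%N.
Proof.
rewrite /sitenorm -big_split; apply: leq_sum => i _ /=.
rewrite mxE -lez_nat PoszD !abszE; exact: ler_normD.
Qed.

Lemma sitenorm_eq0 x : (sitenorm x == 0)%N = (x == 0).
Proof.
apply/idP/eqP => [|->]; last by rewrite /sitenorm big1// => i _; rewrite mxE.
rewrite /sitenorm sum_nat_eq0 => /forallP h; apply/rowP => i.
by have := h i; rewrite mxE absz_eq0 => /eqP.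
Qed.

(** Phrased with [l1norm], so that it is literally the test that [is_srw_law] puts on a step. *)
Definition adjacent : rel 'rV[int]_d := fun u v => l1norm (v - u) == 1.

Lemma adjacentE u v : adjacent u v = (sitenorm (v - u) == 1)%N.
Proof. by rewrite /adjacent l1norm_int. Qed.

Definition unitv (i : 'I_d) (b : bool) : 'rV[int]_d :=
  (-1) ^+ b *: delta_mx ord0 i.

Lemma unitvE i b j : unitv i b ord0 j = (if j == i then (-1) ^+ b else 0) :> int.
Proof. by rewrite /unitv !mxE eqxx /=; case: (j == i); rewrite ?mulr1 ?mulr0. Qed.

Lemma sitenorm_unitv i b : sitenorm (unitv i b) = 1%N.
Proof.
rewrite /sitenorm (bigD1 i)//= big1 => [|j ji]; rewrite unitvE.
  by rewrite eqxx; case: b.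
by rewrite (negPf ji).
Qed.

Lemma sitenorm1P v : (sitenorm v == 1)%N -> exists i b, v = unitv i b.
Proof.
move=> /eqP v1; have vn0 : v != 0 by rewrite -sitenorm_eq0 v1.
have [i vi] : exists i, v ord0 i != 0.
  by apply/existsP; apply: contraNT vn0 => /existsPn h; apply/eqP/rowP => i;
     rewrite mxE; apply/eqP; have := h i; rewrite negbK.
exists i, (v ord0 i < 0); apply/rowP => j.
change (v ord0 j = unitv i (v ord0 i < 0) ord0 j); rewrite unitvE.
move: v1; rewrite /sitenorm (bigD1 i)//=.
case: eqP => [->|/eqP ji].
  by move: (\sum_(_ < d | _) _)%N => n; case: ltP => ? ?; rewrite ?expr0 ?expr1; lia.
rewrite (bigD1 j)//=; move: (\sum_(_ < d | _) _)%N => n.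
by move: vi; rewrite -absz_gt0 => ? ?; apply/eqP; rewrite -absz_eq0; lia.
Qed.

Definition neighbors x : seq 'rV[int]_d :=
  [seq x + unitv i b | i <- enum 'I_d, b <- [:: false; true]].

Lemma mem_neighbors u v : adjacent u v -> v \in neighbors u.
Proof.
rewrite adjacentE => /sitenorm1P[i [b vu]].
apply/allpairsP; exists (i, b); split; rewrite ?mem_enum//; first by case: b {vu}.
by rewrite /= -vu addrC subrK.
Qed.

Lemma big_neighbors (V : nmodType) x (F : 'rV[int]_d -> V) :
  \sum_(v <- neighbors x) F v =
  \sum_(i < d) (F (x + unitv i false) + F (x + unitv i true)).
Proof.
rewrite big_allpairs_dep big_enum/=; apply: eq_bigr => i _.
by rewrite !big_cons big_nil addr0.
Qed.

(* [t] lists the sites visited strictly before [y]: the path is [rcons t y]. *)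
Definition first_passage x y t :=
  [&& head y t == x, y \notin t & sorted adjacent (rcons t y)].

Lemma first_passage_nil x y : first_passage x y [::] = (y == x).
Proof. by rewrite /first_passage/= andbT. Qed.

(** Splits off the first step. For an empty tail [head y t] is [y], the endpoint that a path does
    not list. *)
Lemma first_passage_cons x y u t : first_passage x y (u :: t) =
  [&& u == x, u != y, adjacent u (head y t) & first_passage (head y t) y t].
Proof.
rewrite /first_passage/= eqxx inE negb_or (eq_sym y u) -!andbA; congr (_ && (_ && _)).
by case: t => [|v t] /=; rewrite ?andbT//= andbCA.
Qed.

(** Each step moves one unit towards [y] in a coordinate where the two sites still differ. *)
Lemma first_passage_exists x y : exists t,
  first_passage x y t /\ size t = sitenorm (y - x).
Proof.
move e : (sitenorm (y - x)) => n; elim: n x e => [|n IH] x e.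
  exists [::]; split=> //; rewrite first_passage_nil -subr_eq0 -sitenorm_eq0.
  by rewrite e.
have [i yxi] : exists i, (y - x) ord0 i != 0.
  apply/existsP; apply: contraPT e => /existsPn h.
  suff -> : y - x = 0 by rewrite (eqP (_ : sitenorm 0 == 0)%N) ?sitenorm_eq0.
  by apply/rowP => i; rewrite [RHS]mxE; apply/eqP; have := h i; rewrite negbK.
pose v := unitv i ((y - x) ord0 i < 0).
have yv j : (y - (x + v)) ord0 j =
    (y - x) ord0 j - (if j == i then (-1) ^+ ((y - x) ord0 i < 0)%R else 0).
  by rewrite opprD addrA [LHS]mxE; congr (_ + _); rewrite mxE unitvE.
have e' : sitenorm (y - (x + v)) = n.
  move: e; rewrite /sitenorm (bigD1 i)//= [X in _ -> X = _](bigD1 i)//=.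
  rewrite yv eqxx [X in _ -> (_ + X)%N = _](eq_bigr (fun j => `|(y - x)%R ord0 j|%N)).
    move: (\sum_(_ < d | _) _)%N => m.
    by move: yxi; move: ((y - x) ord0 i) => a; case: ltP; rewrite ?expr0 ?expr1; lia.
  by move=> j ji; rewrite yv (negPf ji) subr0.
have [t [fpt st]] := IH _ e'.
exists (x :: t); split; last by rewrite /= st.
have /eqP ht : head y t == x + v by case/and3P: fpt.
rewrite first_passage_cons eqxx ht fpt adjacentE /= andbT.
rewrite [x + v]addrC addrK sitenorm_unitv eqxx andbT.
apply/eqP => xy; move: e; rewrite xy subrr.
by rewrite (eqP (_ : sitenorm 0 == 0)%N) ?sitenorm_eq0.
Qed.

(* The distance to [y] changes by one at each step, so a path to [y] visits
   every sphere around [y] of smaller radius. *)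
Lemma first_passage_spheres x y t j : first_passage x y t ->
  (0 < j <= sitenorm (y - x))%N -> exists2 z, z \in t & sitenorm (y - z) = j.
Proof.
elim: t x => [|u t IH] x.
  rewrite first_passage_nil => /eqP ->.
  by rewrite subrr (eqP (_ : sitenorm 0 == 0)%N) ?sitenorm_eq0//; lia.
rewrite first_passage_cons => /and4P[/eqP -> _ + fpt] /andP[j0].
rewrite adjacentE leq_eqVlt => xt /predU1P[->|jx].
  by exists x; rewrite ?mem_head.
have [|z zt <-] := IH _ fpt; last by exists z; rewrite // inE zt orbT.
rewrite j0; have := sitenormD (y - head y t) (head y t - x).
by rewrite addrA subrK (eqP xt) addn1 => /(leq_trans jx); rewrite ltnS.
Qed.

(** Picking one visited site on each sphere around [y] of radius [1, ..., sitenorm (y - x)] gives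
    that many distinct sites. *)
Lemma size_undup_first_passage x y t : first_passage x y t ->
  (sitenorm (y - x) <= size (undup t))%N.
Proof.
move=> fpt; set n := sitenorm _.
rewrite -(size_iota 1 n) -(size_map (fun z => sitenorm (y - z)) (undup t)).
apply: uniq_leq_size (iota_uniq _ _) _ => j; rewrite mem_iota add1n ltnS => jn.
have [z zt <-] := first_passage_spheres fpt jn.
by apply: map_f; rewrite mem_undup.
Qed.

End Lattice.

(** * Path sums and superharmonic functions *)

Section FirstPassageSums.
Context (R : realType) (d : nat).
Implicit Types (x y z u v : 'rV[int]_d) (t : seq 'rV[int]_d).

Lemma esum_le_seq (I : choiceType) (S : set I) (a : I -> R) (M : R) :
  (forall T : seq I, uniq T -> (forall i, i \in T -> S i) ->
    \sum_(i <- T) a i <= M) ->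
  (\esum_(i in S) (a i)%:E <= M%:E)%E.
Proof.
move=> h; apply: ge_ereal_sup => _ [A [finA AS] <-].
rewrite fsbig_finite//= sumEFin lee_fin; apply: h; first exact: finmap.fset_uniq.
by move=> i; rewrite in_fset_set// inE => /AS.
Qed.

(** Only an inequality, because [L] may list a site several times. *)
Lemma sum_by_head (y : 'rV[int]_d) (L : seq 'rV[int]_d) (T : seq (seq 'rV[int]_d))
    (F : seq 'rV[int]_d -> R) :
  (forall t, 0 <= F t) -> (forall t, t \in T -> head y t \in L) ->
  \sum_(t <- T) F t <= \sum_(v <- L) \sum_(t <- T | head y t == v) F t.
Proof.
move=> F0 TL; under [leRHS]eq_bigr do rewrite big_mkcond.
rewrite exchange_big/= !big_seq; apply: ler_sum => t tT.
rewrite (big_rem _ (TL _ tT))/= eqxx lerDl sumr_ge0// => v _; by case: ifP.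
Qed.

(** A nonnegative function that is superharmonic off [y], for the step weight [c], dominates the
    path sum with boundary value [f y]. The proof splits off the first step; the length bound [n]
    carries the induction. *)
Lemma first_passage_sum_le (c : R) (f : 'rV[int]_d -> R) y :
  0 <= c -> (forall x, 0 <= f x) ->
  (forall x, x != y -> c * \sum_(v <- neighbors x) f v <= f x) ->
  forall n x (T : seq (seq 'rV[int]_d)), uniq T ->
  (forall t, t \in T -> first_passage x y t /\ (size t <= n)%N) ->
  \sum_(t <- T) c ^+ size t * f y <= f x.
Proof.
move=> c0 f0 fsup; elim=> [|n IH] x T uT hT; have [xy|xy] := eqVneq x y.
- suff : {subset T <= [:: [::]]}.
    move=> /(uniq_leq_size uT); case: T uT hT => [|t [|]//] _ hT _.
      by rewrite big_nil.
    have [_] := hT _ (mem_head _ _); rewrite leqn0 size_eq0 => /eqP ->.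
    by rewrite big_seq1 mul1r xy.
  by move=> t /hT[_]; rewrite leqn0 size_eq0 inE.
- case: T uT hT => [|t T] _ hT; first by rewrite big_nil.
  have [+] := hT _ (mem_head _ _); rewrite leqn0 size_eq0 => /[swap] /eqP ->.
  by rewrite first_passage_nil eq_sym (negPf xy).
(* A first-passage path from [y] to itself has no step, so [T] contains at most the empty path. *)
- suff : {subset T <= [:: [::]]}.
    move=> /(uniq_leq_size uT); case: T uT hT => [|t [|]//] _ hT _.
      by rewrite big_nil.
    have [+ _] := hT _ (mem_head _ _); case: t {hT} => [|u t].
      by rewrite big_seq1 mul1r xy.
    by rewrite first_passage_cons xy; case: eqP.
  move=> t /hT[+ _]; rewrite inE; case: t => // u t.
  by rewrite first_passage_cons xy; case: eqP.
- have hc t : t \in T -> t = x :: behead t /\ [/\ adjacent x (head y (behead t)),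
    first_passage (head y (behead t)) y (behead t) & (size (behead t) <= n)%N].
    move=> /hT[]; case: t => [|u t].
      by rewrite first_passage_nil eq_sym (negPf xy).
    by rewrite first_passage_cons => /and4P[/eqP ->].
  (* Dropping the common first site is injective on [T] and leaves paths that start at neighbors of
     [x]. *)
  pose T' := map behead T.
  have uT' : uniq T'.
    rewrite map_inj_in_uniq// => s t /hc[-> _] /hc[-> _] /= -> //.
  have -> : \sum_(t <- T) c ^+ size t * f y =
      c * \sum_(t <- T') c ^+ size t * f y.
    rewrite big_map mulr_sumr !big_seq; apply: eq_bigr => t /hc[-> _] /=.
    by rewrite exprS mulrA.
  apply: le_trans (fsup _ xy); apply: ler_wpM2l => //.
  have hT' t : t \in T' -> [/\ adjacent x (head y t),
      first_passage (head y t) y t & (size t <= n)%N].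
    by move=> /mapP[s /hc[_ ?] ->].
  apply: (@le_trans _ _ (\sum_(v <- neighbors x)
     \sum_(t <- T' | head y t == v) c ^+ size t * f y)).
    apply: sum_by_head => [t|t /hT'[/mem_neighbors//]].
    by rewrite mulr_ge0 ?exprn_ge0.
  apply: ler_sum => v _; rewrite -big_filter; apply: IH; first exact: filter_uniq.
  by move=> t; rewrite mem_filter => /andP[/eqP <-] /hT'[].
Qed.

Lemma first_passage_esum_le (c : R) (f : 'rV[int]_d -> R) y :
  0 <= c -> (forall x, 0 <= f x) ->
  (forall x, x != y -> c * \sum_(v <- neighbors x) f v <= f x) ->
  forall x, (\esum_(t in [set t | first_passage x y t])
    (c ^+ size t * f y)%:E <= (f x)%:E)%E.
Proof.
move=> c0 f0 fsup x; apply: esum_le_seq => T uT hT.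
apply: (first_passage_sum_le c0 f0 fsup (n := \max_(t <- T) size t)) => // t tT.
by split; [exact: hT|exact: leq_bigmax_seq].
Qed.

End FirstPassageSums.

(** * Partition functions *)

Section Esum.
Context (R : realType) (I : choiceType).
Implicit Types (S : set I) (a u : I -> R).
Local Open Scope ereal_scope.

Lemma esum_ge_term S (a : I -> \bar R) i : S i -> 0 <= a i ->
  a i <= \esum_(j in S) a j.
Proof.
move=> Si ai; apply: esum_ge; exists [set i]; last by rewrite fsbig_set1.
by split; [exact: finite_set1|move=> _ ->].
Qed.

(** The inequality [<=] for all positive factors suffices: the converse is the same inequality for
    the inverse factor. *)
Lemma esumZl S (a : I -> \bar R) (k : R) : (0 <= k)%R ->
  (forall i, S i -> 0 <= a i) ->
  \esum_(i in S) (k%:E * a i) = k%:E * (\esum_(i in S) a i).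
Proof.
move=> + a0; rewrite le_eqVlt => /predU1P[<-|k0].
  by rewrite mul0e esum1// => i _; rewrite mul0e.
have le (h : R) (b : I -> \bar R) : (0 < h)%R -> (forall i, S i -> 0 <= b i) ->
    \esum_(i in S) (h%:E * b i) <= h%:E * (\esum_(i in S) b i).
  move=> h0 b0; apply: ge_ereal_sup => _ [A [finA AS] <-].
  rewrite fsbig_finite//= big_seq -ge0_sume_distrr.
    rewrite -big_seq lee_wpmul2l ?lee_fin ?(ltW h0)//; apply: esum_ge; exists A => //.
    by rewrite fsbig_finite.
  by move=> i; rewrite in_fset_set// inE => /AS; exact: b0.
apply/eqP; rewrite eq_le le//=.
have ki : (0 < k^-1)%R by rewrite invr_gt0.
rewrite -[leRHS]mul1e -(divff (lt0r_neq0 k0)) EFinM -muleA lee_wpmul2l ?lee_fin ?(ltW k0)//.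
apply: (le_trans _ (le _ _ ki _)) => [|i Si]; last by rewrite mule_ge0 ?a0// lee_fin ltW.
by apply: le_esum => i Si; rewrite muleA -EFinM mulVf ?gt_eqF// mul1e.
Qed.

(* The exponential lies above its tangent at [M]: this is Jensen's inequality
   for the weights [a], without normalising them. *)
Lemma esum_jensen S a u (M : R) :
  (forall i, S i -> (0 <= a i)%R) -> (forall i, S i -> (0 <= u i)%R) -> (0 <= M)%R ->
  (\esum_(i in S) (a i)%:E < +oo)%E ->
  (\esum_(i in S) (a i * u i)%:E <= M%:E * (\esum_(i in S) (a i)%:E))%E ->
  ((expR (- M))%:E * (\esum_(i in S) (a i)%:E) <=
   \esum_(i in S) (a i * expR (- u i))%:E)%E.
Proof.
move=> a0 u0 M0 fin hM; set A := \esum_(i in S) _ in fin hM *.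
set B := \esum_(i in S) _.
have Afin : A \is a fin_num.
  by rewrite ge0_fin_numE// esum_ge0// => i /a0; rewrite lee_fin.
suff h : A <= (expR M)%:E * B.
  rewrite -[leRHS]mul1e -[in leRHS](@expRxMexpNx_1 _ M) mulrC EFinM -muleA.
  by rewrite lee_wpmul2l// lee_fin expR_ge0.
(* This sums [a (1 + M - u) <= a e^(M - u)], with the negative term moved to the other side to keep
   all terms nonnegative; the finite [M A] cancels afterwards. *)
have : (1 + M)%:E * A <= (expR M)%:E * B + M%:E * A.
  apply: le_trans (_ : _ <= (expR M)%:E * B + \esum_(i in S) (a i * u i)%:E) _; last first.
    exact: leeD2l.
  have aE0 i : S i -> 0 <= (a i)%:E by move=> Si; rewrite lee_fin a0.
  have bE0 i : S i -> 0 <= (a i * expR (- u i))%:E.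
    by move=> Si; rewrite lee_fin mulr_ge0 ?expR_ge0// a0.
  rewrite -esumZl ?addr_ge0// -[X in _ <= X + _]esumZl ?expR_ge0//.
  rewrite -esumD; last 2 first.
  - by move=> i Si; rewrite mule_ge0 ?bE0// lee_fin expR_ge0.
  - by move=> i Si; rewrite lee_fin !mulr_ge0 ?a0 ?u0.
  apply: le_esum => i Si; rewrite -!EFinM -EFinD lee_fin.
  rewrite mulrCA -expRD.
  have := ler_wpM2l (a0 _ Si) (expR_ge1Dx (M - u i)); lra.
rewrite EFinD ge0_muleDl ?lee_fin// mul1e.
by rewrite leeD2rE// fin_numM.
Qed.

End Esum.

(** * Path weights and their dependence on the parameter *)

Section Weights.
Context (R : realType) (d : nat).
Implicit Types (x y z : 'rV[int]_d) (t : seq 'rV[int]_d) (p q r : R) (l n : nat).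

(* The mean of [exp (- l omega(z))], for a site [z] visited [l] times. *)
Definition visit_factor r l : R := r + (1 - r) * expR (- l%:R).

Lemma visit_factor0 r : visit_factor r 0 = 1.
Proof. by rewrite /visit_factor oppr0 expR0; ring. Qed.

Lemma expRN_nat_le1 l : expR (- l%:R) <= 1 :> R.
Proof. by rewrite -expR0 ler_expR oppr_le0. Qed.

Lemma visit_factor_le1 r l : 0 <= r <= 1 -> visit_factor r l <= 1.
Proof.
move=> /andP[r0 r1]; rewrite /visit_factor.
have := expRN_nat_le1 l; have := expR_ge0 (- l%:R : R); nra.
Qed.

Lemma visit_factor_ge r l : 0 <= r <= 1 -> expR (- l%:R) <= visit_factor r l.
Proof.
move=> /andP[r0 r1]; rewrite /visit_factor.
have := expRN_nat_le1 l; have := expR_ge0 (- l%:R : R); nra.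
Qed.

Lemma visit_factor_gt0 r l : 0 <= r <= 1 -> 0 < visit_factor r l.
Proof. by move=> r01; exact: lt_le_trans (expR_gt0 _) (visit_factor_ge l r01). Qed.

Lemma visit_factor_antitone r l n : 0 <= r <= 1 -> (l <= n)%N ->
  visit_factor r n <= visit_factor r l.
Proof.
move=> /andP[r0 r1] ln; rewrite /visit_factor lerD2l ler_wpM2l ?subr_ge0//.
by rewrite ler_expR lerN2 ler_nat.
Qed.

Lemma visit_factor_mono q r l : r <= q -> visit_factor r l <= visit_factor q l.
Proof. by rewrite /visit_factor; have := expRN_nat_le1 l; nra. Qed.

Lemma expRN_nat_le l : (0 < l)%N -> expR (- l%:R) <= expR (- 1) :> R.
Proof. by move=> l0; rewrite ler_expR lerN2 ler1n. Qed.

(** The mean of the exponential of minus the potential collected along [t]; independence makes it a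
    product over the distinct sites. *)
Definition path_factor r t : R :=
  \prod_(z <- undup t) visit_factor r (count_mem z t).

Lemma path_factor_ge0 r t : 0 <= r <= 1 -> 0 <= path_factor r t.
Proof. by move=> r01; apply: prodr_ge0 => z _; rewrite ltW// visit_factor_gt0. Qed.

Lemma path_factor_le1 r t : 0 <= r <= 1 -> path_factor r t <= 1.
Proof.
by move=> r01; apply: prodr_ile1 => z _; rewrite visit_factor_le1// ltW// visit_factor_gt0.
Qed.

Lemma expR_sum_visits (f : 'rV[int]_d -> R) t :
  expR (- \sum_(z <- t) f z) =
  \prod_(z <- undup t) expR (- f z) ^+ count_mem z t.
Proof.
by rewrite -sumrN expR_sum -[LHS]big_undup_iterop_count.
Qed.

Lemma ler_prod_visits (F G : 'rV[int]_d -> R) t :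
  (forall z, z \in t -> 0 <= F z <= G z) ->
  \prod_(z <- undup t) F z <= \prod_(z <- undup t) G z.
Proof.
by move=> FG; rewrite !big_seq; apply: ler_prod => z; rewrite mem_undup; exact: FG.
Qed.

Lemma path_factor_ge r t : 0 <= r <= 1 -> expR (- (size t)%:R) <= path_factor r t.
Proof.
move=> r01; have -> : - (size t)%:R = - \sum_(z <- t) (1 : R).
  by rewrite big_const_seq count_predT iter_addr_0.
rewrite expR_sum_visits; apply: ler_prod_visits => z _.
by rewrite exprn_ge0 ?expR_ge0//= -expRM_natl mulrN1 visit_factor_ge.
Qed.

Definition step_prob : R := (2 * d%:R)^-1.

Lemma step_prob_ge0 : 0 <= step_prob.
Proof. by rewrite invr_ge0 mulr_ge0. Qed.

Lemma sum_neighbors_cst (a : R) x : (0 < d)%N ->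
  step_prob * \sum_(v <- neighbors x) a = a.
Proof.
move=> d0; rewrite big_neighbors sumr_const card_ord -mulr_natr /step_prob.
by field; rewrite pnatr_eq0 -lt0n.
Qed.

Lemma step_prob_gt0 : (0 < d)%N -> 0 < step_prob.
Proof. by move=> d0; rewrite invr_gt0 mulr_gt0// ltr0n. Qed.

Definition path_weight_at r t : R := step_prob ^+ size t * path_factor r t.

Lemma path_weight_at_ge0 r t : 0 <= r <= 1 -> 0 <= path_weight_at r t.
Proof. by move=> r01; rewrite mulr_ge0 ?exprn_ge0 ?step_prob_ge0 ?path_factor_ge0. Qed.

Definition partition_function r x y : \bar R :=
  \esum_(t in [set t | first_passage x y t]) (path_weight_at r t)%:E.

(** The sum is the probability that the walk ever hits [y]; the bound comes from the harmonic
    function 1. *)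
Lemma esum_step_prob_le1 x y : (0 < d)%N ->
  (\esum_(t in [set t | first_passage x y t]) (step_prob ^+ size t)%:E <= 1)%E.
Proof.
move=> d0; have := @first_passage_esum_le R d step_prob (fun=> 1) y step_prob_ge0
  (fun=> ler01) _ x.
under eq_esum do rewrite mulr1; apply => z _.
by rewrite sum_neighbors_cst.
Qed.

Lemma partition_function_ge0 r x y : 0 <= r <= 1 -> (0 <= partition_function r x y)%E.
Proof. by move=> r01; apply: esum_ge0 => t _; rewrite lee_fin path_weight_at_ge0. Qed.

Lemma partition_function_le1 r x y : (0 < d)%N -> 0 <= r <= 1 ->
  (partition_function r x y <= 1)%E.
Proof.
move=> d0 r01; apply: le_trans (esum_step_prob_le1 x y d0); apply: le_esum => t _.
by rewrite lee_fin ler_piMr ?exprn_ge0 ?step_prob_ge0// path_factor_le1.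
Qed.

Lemma partition_function_fin r x y : (0 < d)%N -> 0 <= r <= 1 ->
  partition_function r x y \is a fin_num.
Proof.
move=> d0 r01; rewrite ge0_fin_numE ?partition_function_ge0//.
by rewrite (le_lt_trans (partition_function_le1 _ _ d0 r01))// ltry.
Qed.

(** Keeps a single shortest path, whose potential is at most 1 at each site. *)
Lemma partition_function_ge r x y : 0 <= r <= 1 ->
  (((step_prob * expR (- 1)) ^+ sitenorm (y - x))%:E <= partition_function r x y)%E.
Proof.
move=> r01; have [t [fpt <-]] := first_passage_exists x y.
apply: (@le_trans _ _ (path_weight_at r t)%:E); last first.
  by apply: esum_ge_term => //; rewrite lee_fin path_weight_at_ge0.
rewrite lee_fin exprMn ler_wpM2l ?exprn_ge0 ?step_prob_ge0//.
by rewrite -expRM_natl mulrN1 path_factor_ge.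
Qed.

(** At a site visited [l >= 1] times the factors differ by [(q - p) (1 - e^(-l)) >= k]. As the
    factor for [q] is at most 1, the one for [p] is at most [1 - k <= e^(-k)] times it. *)
Lemma path_factor_lower p q t : 0 < p -> p < q -> q < 1 ->
  path_factor p t <=
  expR (- ((1 - expR (- 1)) * (q - p)) * (size (undup t))%:R) * path_factor q t.
Proof.
move=> p0 pq q1; set k := (1 - _) * _.
have -> : - k * (size (undup t))%:R = \sum_(z <- undup t) - k.
  by rewrite big_const_seq count_predT iter_addr_0 mulr_natr.
rewrite expR_sum -big_split; apply: ler_prod_visits => z zt /=.
have l0 : (0 < count_mem z t)%N by rewrite -has_count has_pred1.
have p01 : 0 <= p <= 1 by lra.
have q01 : 0 <= q <= 1 by lra.
rewrite ltW ?visit_factor_gt0//=.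
have := expR_ge1Dx (- k); have := visit_factor_le1 (count_mem z t) q01.
have := visit_factor_gt0 (count_mem z t) q01.
have : visit_factor p (count_mem z t) <= visit_factor q (count_mem z t) - k.
  rewrite /visit_factor /k; have := expRN_nat_le l0; nra.
have : 0 <= k.
  by rewrite mulr_ge0 ?subr_ge0 ?(ltW pq)// -expR0 ler_expR; lra.
nra.
Qed.

Lemma partition_function_lower p q x y : 0 < p -> p < q -> q < 1 ->
  (partition_function p x y <=
   (expR (- ((1 - expR (- 1)) * (q - p)) * (sitenorm (y - x))%:R))%:E *
     partition_function q x y)%E.
Proof.
move=> p0 pq q1; have q01 : 0 <= q <= 1 by lra.
rewrite -esumZl ?expR_ge0//; last by move=> t _; rewrite lee_fin path_weight_at_ge0.
apply: le_esum => t fpt; rewrite -EFinM lee_fin mulrCA.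
rewrite ler_wpM2l ?exprn_ge0 ?step_prob_ge0//.
apply: le_trans (path_factor_lower t p0 pq q1) _.
rewrite ler_wpM2r ?path_factor_ge0// ler_expR !mulNr lerN2 ler_wpM2l//.
  by rewrite mulr_ge0 ?subr_ge0 ?(ltW pq)// -expR0 ler_expR; lra.
by rewrite ler_nat; exact: size_undup_first_passage fpt.
Qed.

(** Here [k g(l)] bounds the log-ratio of the factors for [q] and [p] at a site visited [l] times,
    and [M] bounds the mean, under the weights for [q], of the sum of [g] over the visited sites.
    Jensen's inequality concludes. *)
Lemma partition_function_upper p q (k M : R) (g : nat -> R) x y : (0 < d)%N ->
  0 < p < 1 -> 0 < q < 1 ->
  0 <= k -> 0 <= M -> (forall l, 0 <= g l) ->
  (forall l, (0 < l)%N -> visit_factor q l * expR (- (k * g l)) <= visit_factor p l) ->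
  (\esum_(t in [set t | first_passage x y t])
     (path_weight_at q t * \sum_(z <- undup t) g (count_mem z t))%:E <=
   M%:E * partition_function q x y)%E ->
  ((expR (- (k * M)))%:E * partition_function q x y <= partition_function p x y)%E.
Proof.
move=> d0 p01 q01 k0 M0 g0 hg hM.
have {}p01 : 0 <= p <= 1 by lra.
have {}q01 : 0 <= q <= 1 by lra.
pose u t := k * \sum_(z <- undup t) g (count_mem z t).
have u0 t : 0 <= u t by rewrite mulr_ge0// sumr_ge0.
apply: le_trans (esum_jensen (u := u) _ _ _ _ _) _ => //.
- by move=> t _; exact: path_weight_at_ge0.
- exact: mulr_ge0.
- by rewrite -ge0_fin_numE ?partition_function_ge0// partition_function_fin.
- under eq_esum do rewrite /u mulrCA EFinM.
  rewrite esumZl//; first by rewrite EFinM -muleA lee_wpmul2l// lee_fin.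
  by move=> t _; rewrite lee_fin mulr_ge0 ?path_weight_at_ge0// sumr_ge0.
apply: le_esum => t _; rewrite lee_fin -mulrA.
rewrite ler_wpM2l ?exprn_ge0 ?step_prob_ge0// /u mulr_sumr -sumrN expR_sum.
rewrite -big_split; apply: ler_prod_visits => z zt /=.
rewrite hg ?andbT; first by rewrite mulr_ge0 ?expR_ge0// ltW ?visit_factor_gt0.
by rewrite -has_count has_pred1.
Qed.

End Weights.

(** * The range and the loops of a path *)

Section MeanRange.
Context (R : realType) (d : nat).
Hypothesis d0 : (0 < d)%N.
Implicit Types (x y z : 'rV[int]_d) (t s : seq 'rV[int]_d) (q : R).

(* [N <= K n + e^(c (N - K n)) / c] splits the mean of the range [N] into a
   linear term and an exponential moment. With [e^c = 1/theta] the latter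
   compensates the factor [theta^N] of the weight, and [K] is chosen so that the
   remaining [e^(- c K n)] is the weight of a straight path. *)
Lemma mean_range_le (q0 : R) : 0 < q0 < 1 -> exists2 K : R, 0 < K &
  forall q x y, 0 < q <= q0 -> x != y ->
  (\esum_(t in [set t | first_passage x y t])
     (path_weight_at q t * (size (undup t))%:R)%:E <=
   (K * (sitenorm (y - x))%:R)%:E * partition_function q x y)%E.
Proof.
(* The largest factor that a visited site can have for any [q <= q0]. *)
move=> q01; pose th := visit_factor q0 1.
have e1 : expR (- 1) < 1 :> R by rewrite -[ltRHS]expR0 ltr_expR; lra.
have th0 : 0 < th by apply: visit_factor_gt0; lra.
have th1 : th < 1.
  have : 0 < (1 - q0) * (1 - expR (- 1)) by rewrite mulr_gt0 ?subr_gt0//; lra.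
  by rewrite /th /visit_factor mulr1n; lra.
pose c : R := - ln th.
have c0 : 0 < c by rewrite oppr_gt0 ln_lt0// th0.
have eth : expR (- c) = th by rewrite opprK lnK.
have sp0 := @step_prob_gt0 R _ d0.
have sp1 : step_prob R d <= 1.
  by rewrite invf_le1 ?mulr_gt0 ?ltr0n// -natrM ler1n muln_gt0.
(* [K] solves [e^(- c K) = step_prob / e], the factor per step in [partition_function_ge]. *)
pose K : R := (1 - ln (step_prob R d)) / c.
have lnsp : ln (step_prob R d) <= 0 by rewrite ln_le0.
have K0 : 0 < K by rewrite divr_gt0//; lra.
have cK : expR (- (c * K)) = step_prob R d * expR (- 1).
  rewrite /K mulrCA mulfV ?gt_eqF// mulr1 opprB expRD lnK//; exact: sp0.
exists (K + c^-1); first by rewrite addr_gt0// invr_gt0.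
move=> q x y /andP[qpos qle] xy; set n := sitenorm _.
have q01' : 0 <= q <= 1 by lra.
have n1 : 1 <= n%:R :> R.
  by rewrite ler1n lt0n sitenorm_eq0 subr_eq0 eq_sym.
have pf t : path_factor q t <= expR (- (c * (size (undup t))%:R)).
  have -> : - (c * (size (undup t))%:R) = \sum_(z <- undup t) - c.
    by rewrite big_const_seq count_predT iter_addr_0 -mulNr mulr_natr.
  rewrite expR_sum eth; apply: ler_prod_visits => z zt.
  rewrite ltW ?visit_factor_gt0//=; apply: (@le_trans _ _ (visit_factor q 1)).
    by apply: visit_factor_antitone => //; rewrite -has_count has_pred1.
  exact: visit_factor_mono.
pose a t : R := path_weight_at q t; pose b t : R := step_prob R d ^+ size t.
have hN t : a t * (size (undup t))%:R <=
    K * n%:R * a t + (expR (- (c * K)) ^+ n / c) * b t.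
  set N := (size (undup t))%:R; rewrite -expRM_natr.
  have h1 : N <= K * n%:R + expR (c * (N - K * n%:R)) / c.
    rewrite -lerBlDl ler_pdivlMr// mulrC.
    by apply: le_trans (expR_ge1Dx _); lra.
  apply: le_trans (ler_wpM2l (path_weight_at_ge0 t q01') h1) _.
  rewrite mulrDr [a t * _]mulrC lerD2l /a /path_weight_at -/(b t).
  set E := expR (c * _).
  rewrite (_ : b t * path_factor q t * (E / c) = path_factor q t * E * (b t / c));
    last by ring.
  rewrite [leRHS]mulrAC -[leRHS]mulrA; apply: ler_wpM2r.
    by rewrite divr_ge0 ?exprn_ge0 ?(ltW sp0) ?(ltW c0).
  apply: le_trans (ler_wpM2r (expR_ge0 _) (pf t)) _.
  by rewrite -expRD ler_expR -/N; lra.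
apply: (@le_trans _ _ (\esum_(t in [set t | first_passage x y t])
  (((K * n%:R)%:E * (a t)%:E) + ((expR (- (c * K)) ^+ n / c)%:E * (b t)%:E)))%E).
  by apply: le_esum => t _; rewrite -!EFinM -EFinD lee_fin.
have a0 t : (0 <= (a t)%:E)%E by rewrite lee_fin path_weight_at_ge0.
have b0 t : (0 <= (b t)%:E)%E by rewrite lee_fin exprn_ge0// ltW.
have Kn0 : 0 <= K * n%:R by rewrite mulr_ge0// ltW.
have ec0 : 0 <= expR (- (c * K)) ^+ n / c by rewrite divr_ge0 ?exprn_ge0 ?expR_ge0// ltW.
rewrite esumD => [|t _|t _]; [|by rewrite mule_ge0|by rewrite mule_ge0].
rewrite !esumZl// mulrDl EFinD ge0_muleDl ?lee_fin//; last first.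
  by rewrite mulr_ge0// invr_ge0 ltW.
(* The remaining term is at most [1 / c] times the weight bound of a shortest path, hence at most
   [n / c] times the partition function since [1 <= n]; this is the [c^-1] in the constant. *)
apply: leeD2l; rewrite cK.
apply: le_trans (lee_wpmul2l _ (esum_step_prob_le1 R x y d0)) _.
  by rewrite lee_fin -cK.
rewrite mule1 [_ ^+ n / c]mulrC.
apply: (@le_trans _ _ ((c^-1)%:E * partition_function q x y)%E).
  rewrite EFinM lee_wpmul2l// ?lee_fin ?invr_ge0 ?(ltW c0)//.
  exact: partition_function_ge.
rewrite lee_wpmul2r ?partition_function_ge0// lee_fin ler_peMr// invr_ge0 ltW//.
Qed.

End MeanRange.

(** * Cutting loops at a site *)

Section Loops.
Context (R : realType) (d : nat).
Implicit Types (x y z u : 'rV[int]_d) (t s : seq 'rV[int]_d) (q : R).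

Lemma le_esum_inj (I J : choiceType) (S : set I) (T : set J) (g : I -> J)
    (a : I -> \bar R) (b : J -> \bar R) :
  {in S &, injective g} -> (forall i, S i -> T (g i)) ->
  (forall i, S i -> (a i <= b (g i))%E) ->
  (\esum_(i in S) a i <= \esum_(j in T) b j)%E.
Proof.
move=> ginj gST ab; apply: (le_trans (le_esum ab)).
rewrite -(reindex_esum _ _ g b (inj_bij ginj)).
apply: ge_ereal_sup => _ [A [finA AS] <-]; apply: ereal_sup_ubound.
by exists A => //; split => // j /AS[i Si <-]; exact: gST.
Qed.

Lemma sorted_cat_cons (T : Type) (e : rel T) (t1 t2 : seq T) (z : T) :
  sorted e (t1 ++ z :: t2) = sorted e (rcons t1 z) && path e z t2.
Proof. by case: t1 => [|a t1] //=; rewrite cat_path rcons_path andbA. Qed.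

(* The contribution to the weight of the sites other than [z]. *)
Definition path_factor_off z q t : R :=
  \prod_(u <- undup t | u != z) visit_factor q (count_mem u t).

Lemma path_factor_off_le1 z q t : 0 <= q <= 1 -> 0 <= path_factor_off z q t <= 1.
Proof.
move=> q01; rewrite prodr_ge0 => [|u _]; last by rewrite ltW// visit_factor_gt0.
by apply: prodr_ile1 => u _; rewrite visit_factor_le1// ltW// visit_factor_gt0.
Qed.

Lemma path_factorE z q t : z \in t ->
  path_factor q t = visit_factor q (count_mem z t) * path_factor_off z q t.
Proof.
by move=> zt; rewrite /path_factor (bigD1_seq z) ?mem_undup ?undup_uniq.
Qed.

(** Fewer visits raise every factor. A site missed by [t'] has factor [visit_factor q 0 = 1], so
    both products can run over the sites of [t]. *)
Lemma path_factor_off_le z q t t' : 0 <= q <= 1 ->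
  (forall u, count_mem u t' <= count_mem u t)%N ->
  path_factor_off z q t <= path_factor_off z q t'.
Proof.
move=> q01 tt'; have sub : {subset t' <= t}.
  by move=> u; rewrite -!has_pred1 !has_count => /leq_trans; apply.
have -> : path_factor_off z q t' =
    \prod_(u <- undup t | u != z) visit_factor q (count_mem u t').
  rewrite [RHS](bigID (mem t'))/= [X in _ * X]big1 ?mulr1; last first.
    by move=> u /andP[_ /count_memPn ->]; rewrite visit_factor0.
  rewrite /path_factor_off -big_filter -[RHS]big_filter; apply: perm_big.
  apply: uniq_perm; rewrite ?filter_uniq ?undup_uniq// => u.
  rewrite !mem_filter !mem_undup -andbA; congr (_ && _).
  by rewrite andbC; case: (boolP (u \in t')) => [/sub ->|]; rewrite ?andbF.
apply: ler_prod => u _.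
by rewrite visit_factor_antitone// ltW// visit_factor_gt0.
Qed.

Definition off_weight z q t : R := step_prob R d ^+ size t * path_factor_off z q t.

Lemma off_weight_ge0 z q t : 0 <= q <= 1 -> 0 <= off_weight z q t.
Proof.
move=> q01; rewrite mulr_ge0 ?exprn_ge0 ?step_prob_ge0//.
by have /andP[] := path_factor_off_le1 z t q01.
Qed.

(** A loop that returns to [z] only at its end. The final [z] is not listed, so [size s] is the
    number of steps; an empty [s'] is excluded because [z] is not adjacent to itself. *)
Definition loop z s := exists2 s', s = z :: s' &
  adjacent z (head z s') /\ first_passage (head z s') z s'.

(** With [i] the time of the first visit to [z] and [i + j] that of the second, this is the path
    without the loop between them, paired with that loop. *)
Definition cut_loop z t :=
  let i := index z t in let j := (index z (drop i.+1 t)).+1 in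
  (take i t ++ drop (i + j) t, take j (drop i t)).

(** Reinserts the loop at the first visit to [z], which undoes [cut_loop]. *)
Definition paste_loop z (p : seq 'rV[int]_d * seq 'rV[int]_d) :=
  let i := index z p.1 in take i p.1 ++ p.2 ++ drop i p.1.

Lemma split_first (T : eqType) (z : T) (t : seq T) : z \in t ->
  exists t1 t2 : seq T, t = t1 ++ z :: t2 /\ z \notin t1.
Proof.
elim: t => // a t IH; rewrite inE; have [->|za /= /IH[t1 [t2 [-> zt1]]]] := eqVneq z a.
  by exists [::], t.
by exists (a :: t1), t2; rewrite inE negb_or za.
Qed.

Lemma index_cat_cons (T : eqType) (z : T) (t1 t2 : seq T) : z \notin t1 ->
  index z (t1 ++ z :: t2) = size t1.
Proof. by move=> /negPf zt1; rewrite index_cat zt1 /= eqxx addn0. Qed.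

Lemma cut_loop_spec z t : (1 < count_mem z t)%N -> exists t1 s t2,
  [/\ t = t1 ++ z :: s ++ z :: t2, z \notin t1, z \notin s
    & cut_loop z t = (t1 ++ z :: t2, z :: s)].
Proof.
move=> z2; have zt : z \in t by rewrite -has_pred1 has_count (ltn_trans _ z2).
have [t1 [t3 [tE zt1]]] := split_first zt.
have zt3 : z \in t3.
  rewrite -has_pred1 has_count; move: z2; rewrite tE count_cat (count_memPn zt1) /=.
  by rewrite eqxx.
have [s [t2 [t3E zs]]] := split_first zt3.
exists t1, s, t2; split; rewrite -?t3E//.
rewrite /cut_loop tE index_cat_cons//.
rewrite [drop _.+1 _](_ : _ = t3); last by rewrite -cat_rcons drop_size_cat ?size_rcons.
rewrite t3E index_cat_cons// take_size_cat//.
congr pair; last by rewrite drop_size_cat//= take_size_cat.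
by rewrite -[z :: s ++ _]/((z :: s) ++ _) catA drop_size_cat ?size_cat.
Qed.

Lemma cut_loopK z t : (1 < count_mem z t)%N -> paste_loop z (cut_loop z t) = t.
Proof.
move=> /cut_loop_spec[t1 [s [t2 [-> zt1 zs ->]]]].
by rewrite /paste_loop /= index_cat_cons// take_size_cat// drop_size_cat.
Qed.

Lemma cut_loop_first_passage x y z t : (1 < count_mem z t)%N -> first_passage x y t ->
  [/\ first_passage x y (cut_loop z t).1, z \in (cut_loop z t).1 & loop z (cut_loop z t).2].
Proof.
move=> /cut_loop_spec[t1 [s [t2 [-> zt1 zs ->]]]] /and3P[ht yt].
rewrite rcons_cat rcons_cons rcons_cat rcons_cons sorted_cat_cons cat_path /=.
move=> /and3P[srt1 srts /andP[zs' srt2]] /=; split.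
- apply/and3P; split; first by case: t1 ht {zt1 yt srt1}.
    by move: yt; rewrite !(mem_cat, inE) !negb_or => /and4P[-> -> _ /andP[_ ->]].
  by rewrite rcons_cat rcons_cons sorted_cat_cons srt1.
- by rewrite mem_cat mem_head orbT.
- exists s => //; rewrite /first_passage eqxx zs /=.
  have : path (@adjacent d) z (rcons s z) by rewrite rcons_path srts.
  by case: (s) => [|a s'] /= /andP[-> //] ->.
Qed.

(** Cutting the first loop is injective, the lengths of the two pieces add up, and the factors off
    [z] do not decrease. The sum over pairs then factorizes, the loops contributing at most
    [rho]. *)
Lemma loop_cut_le x y z q (rho : R) : 0 <= q <= 1 -> 0 <= rho ->
  (\esum_(s in loop z) (step_prob R d ^+ size s)%:E <= rho%:E)%E ->
  (\esum_(t in [set t | first_passage x y t /\ (1 < count_mem z t)%N])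
     (off_weight z q t)%:E <=
   rho%:E * (\esum_(t in [set t | first_passage x y t /\ z \in t])
     (off_weight z q t)%:E))%E.
Proof.
move=> q01 rho0 hrho; pose W t := (off_weight z q t)%:E; set A := [set t : seq 'rV[int]_d | _ /\ z \in t].
have W0 t : (0 <= W t)%E.
  by rewrite lee_fin off_weight_ge0.
pose b (p : seq 'rV[int]_d * seq 'rV[int]_d) : \bar R :=
  (W p.1 * (step_prob R d ^+ size p.2)%:E)%E.
have b0 p : (0 <= b p)%E by rewrite mule_ge0// lee_fin exprn_ge0 ?step_prob_ge0.
apply: (@le_trans _ _ (\esum_(p in A `*`` (fun=> loop z)) b p)%E).
  apply: (le_esum_inj (g := cut_loop z)) => //.
  - by move=> t t'; rewrite !inE => -[_ zt] [_ zt'] /(congr1 (paste_loop z));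
      rewrite !cut_loopK.
  - by move=> t [fpt /cut_loop_first_passage /(_ fpt)[]].
  - move=> t [fpt zt]; rewrite /b /W -EFinM lee_fin mulrAC -exprD.
    have [t1 [s [t2 [tE zt1 zs ->]]]] := cut_loop_spec zt.
    have -> : (size (t1 ++ z :: t2, z :: s).1 + size (t1 ++ z :: t2, z :: s).2 =
        size t)%N.
      by rewrite tE /= !size_cat /= size_cat /=; lia.
    rewrite ler_wpM2l ?exprn_ge0 ?step_prob_ge0//.
    apply: path_factor_off_le => // u.
    by rewrite tE /= !count_cat /= count_cat /=; lia.
rewrite -(esum_esum (a := fun t s => (W t * (step_prob R d ^+ size s)%:E)%E)); last first.
  by move=> t s _ _; exact: (b0 (t, s)).
rewrite -esumZl//; last by move=> t _; exact: W0.
apply: le_esum => t _; rewrite esumZl ?off_weight_ge0//; last first.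
  by move=> s _; rewrite lee_fin exprn_ge0 ?step_prob_ge0.
by rewrite [leRHS]muleC; apply: lee_wpmul2l => //; exact: W0.
Qed.

(** Let [W] be the left side. Paths with several visits to [z] contribute at most [rho W]. With a
    single visit the factor at [z] is at least [e^(-1)], so these contribute at most [e] times the
    full weights. Solving for [W] gives the bound. *)
Lemma off_weight_esum_le x y z q (rho : R) : (0 < d)%N -> 0 <= q <= 1 ->
  0 <= rho < 1 ->
  (\esum_(s in loop z) (step_prob R d ^+ size s)%:E <= rho%:E)%E ->
  (\esum_(t in [set t | first_passage x y t /\ z \in t])
     (off_weight z q t)%:E <=
   (expR 1 / (1 - rho))%:E *
   (\esum_(t in [set t | first_passage x y t /\ z \in t]) (path_weight_at q t)%:E))%E.
Proof.
move=> d0 q01 /andP[rho0 rho1] hrho; have := loop_cut_le x y q01 rho0 hrho.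
pose W t := (off_weight z q t)%:E.
set A := [set t : seq 'rV[int]_d | _ /\ z \in t]; set A2 := [set t : seq 'rV[int]_d | _ /\ (1 < _)%N] => hA2.
have W0 t : (0 <= W t)%E.
  by rewrite lee_fin off_weight_ge0.
(* Finiteness allows [rho W] to be subtracted from both sides. *)
have Afin : \esum_(t in A) W t \is a fin_num.
  rewrite ge0_fin_numE ?esum_ge0//; apply: (@le_lt_trans _ _ 1%E); last exact: ltry.
  apply: le_trans (esum_step_prob_le1 R x y d0).
  apply: (le_esum_inj (g := id)) => // [t []//|t _].
  rewrite lee_fin ler_piMr ?exprn_ge0 ?step_prob_ge0//.
  by have /andP[] := path_factor_off_le1 z t q01.
have AA2 : A `&` [set t | (1 < count_mem z t)%N] = A2.
  apply/seteqP; split => [t [[fpt _] zt]//|t [fpt zt]]; split => //; split => //.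
  by rewrite -has_pred1 has_count (ltn_trans _ zt).
have hA1 : (\esum_(t in A `&` ~` [set t | (1 < count_mem z t)%N]) W t <=
    (expR 1)%:E * (\esum_(t in A) (path_weight_at q t)%:E))%E.
  rewrite -esumZl ?expR_ge0//; last by move=> t _; rewrite lee_fin path_weight_at_ge0.
  apply: (le_esum_inj (g := id)) => // [t []//|t [[_ zt] /negP]].
  rewrite -leqNgt => z1; have {}z1 : count_mem z t = 1%N.
    by apply/eqP; rewrite eqn_leq z1 -has_count has_pred1.
  rewrite -EFinM lee_fin /path_weight_at /off_weight (path_factorE _ zt) z1.
  rewrite [leRHS]mulrCA; apply: ler_wpM2l; first by rewrite exprn_ge0 ?step_prob_ge0.
  rewrite mulrA ler_peMl//.
    by have /andP[] := path_factor_off_le1 z t q01.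
  rewrite -[leLHS](@expRxMexpNx_1 _ 1) ler_wpM2l ?expR_ge0//.
  exact: (visit_factor_ge 1 q01).
have : (\esum_(t in A) W t <= rho%:E * (\esum_(t in A) W t) +
    (expR 1)%:E * (\esum_(t in A) (path_weight_at q t)%:E))%E.
  by rewrite {1}(esumID [set t | (1 < count_mem z t)%N])// AA2 leeD.
rewrite -[X in (X <= _)%E]mul1e -[1%E](_ : ((1 - rho)%:E + rho%:E)%E = _); last first.
  by rewrite -EFinD subrK.
have rho1' : 0 < 1 - rho by rewrite subr_gt0.
rewrite ge0_muleDl ?lee_fin ?(ltW rho1')// addeC leeD2lE ?fin_numM// => h.
have -> : (\esum_(t in A) (off_weight z q t)%:E =
    ((1 - rho)^-1)%:E * ((1 - rho)%:E * (\esum_(t in A) W t)))%E.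
  by rewrite muleA -EFinM mulVf ?mul1e// lt0r_neq0.
rewrite mulrC EFinM -muleA lee_wpmul2l// lee_fin invr_ge0 ltW//.
Qed.

Lemma exchange_esum (I J : choiceType) (A : set I) (B : set J) (a : I -> J -> \bar R) :
  (forall i j, (0 <= a i j)%E) ->
  \esum_(i in A) \esum_(j in B) a i j = \esum_(j in B) \esum_(i in A) a i j.
Proof.
move=> a0; rewrite !esum_esum// (reindex_esum (B `*`` (fun=> A)) _ (fun p => (p.2, p.1)))//.
split => [[j i] []//|[i j] [i' j'] _ _ [-> ->]//|[i j] [Ai Bj]].
by exists (j, i).
Qed.

(** Puts a sum over visited sites into the form of a sum over all sites, ready to be exchanged with
    the sum over paths. *)
Lemma esum_seq (I : choiceType) (s : seq I) (f : I -> R) : uniq s ->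
  (forall i, 0 <= f i) ->
  \esum_(i in setT) (if i \in s then f i else 0)%:E = (\sum_(i <- s) f i)%:E.
Proof.
move=> us f0; rewrite -sumEFin fsbig_seq// -esum_fset; last 2 first.
- exact: finite_seq.
- by move=> i _; rewrite lee_fin.
rewrite [RHS]esum_mkcond; apply: eq_esum => i _.
have -> : (i \in [set` s]) = (i \in s) by apply/idP/idP; rewrite inE.
by case: ifP.
Qed.

(* At a site visited once, putting back its factor costs at most [e]; multiple
   visits are cut away loop by loop. *)
Lemma inverse_factor_sum_le x y q (rho : R) : (0 < d)%N -> 0 <= q <= 1 ->
  0 <= rho < 1 ->
  (forall z, (\esum_(s in loop z) (step_prob R d ^+ size s)%:E <= rho%:E)%E) ->
  (\esum_(t in [set t | first_passage x y t])
     (path_weight_at q t *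
        \sum_(z <- undup t) (visit_factor q (count_mem z t))^-1)%:E <=
   (expR 1 / (1 - rho))%:E *
   (\esum_(t in [set t | first_passage x y t])
      (path_weight_at q t * (size (undup t))%:R)%:E))%E.
Proof.
move=> d0 q01 rho01 hrho; set S := [set t | _].
have restrict z (F : seq 'rV[int]_d -> R) :
    \esum_(t in S) (if z \in undup t then F t else 0)%:E =
    \esum_(t in [set t | first_passage x y t /\ z \in t]) (F t)%:E.
  rewrite esum_mkcond [RHS]esum_mkcond; apply: eq_esum => t _.
  rewrite mem_undup; case: (boolP (z \in t)) => zt.
    congr (if _ then _ else _).
    by apply/idP/idP; rewrite !inE /S /=; [move=> ?; split|case].
  rewrite if_same [RHS]ifF//; apply/negP; rewrite inE => -[_].
  by rewrite (negPf zt).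
(* Dividing the weight by the factor at [z] leaves the weight off [z]; then the sums over sites and
   paths are exchanged. *)
have -> : \esum_(t in S) (path_weight_at q t *
        \sum_(z <- undup t) (visit_factor q (count_mem z t))^-1)%:E =
    \esum_(z in setT) \esum_(t in [set t | first_passage x y t /\ z \in t])
      (off_weight z q t)%:E.
  under [RHS]eq_esum do rewrite -restrict; rewrite exchange_esum; last first.
    by move=> z t; case: ifP; rewrite lee_fin ?off_weight_ge0.
  apply: eq_esum => t fpt; rewrite esum_seq ?undup_uniq//; last first.
    by move=> z; exact: off_weight_ge0.
  rewrite mulr_sumr !big_seq; congr EFin; apply: eq_bigr => z; rewrite mem_undup => zt.
  rewrite /path_weight_at (path_factorE _ zt) -mulrA.
  by rewrite [visit_factor _ _ * _]mulrC mulfK// lt0r_neq0// visit_factor_gt0.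
have -> : \esum_(t in S) (path_weight_at q t * (size (undup t))%:R)%:E =
    \esum_(z in setT) \esum_(t in [set t | first_passage x y t /\ z \in t])
      (path_weight_at q t)%:E.
  under [RHS]eq_esum do rewrite -restrict; rewrite exchange_esum; last first.
    by move=> z t; case: ifP; rewrite lee_fin ?path_weight_at_ge0.
  apply: eq_esum => t fpt; rewrite esum_seq ?undup_uniq//; last first.
    by move=> z; exact: path_weight_at_ge0.
  by rewrite big_const_seq count_predT iter_addr_0 mulr_natr.
have k0 : 0 <= expR 1 / (1 - rho).
  by rewrite divr_ge0 ?expR_ge0// subr_ge0; case/andP: rho01 => _ /ltW.
rewrite -esumZl//; last first.
  by move=> z _; apply: esum_ge0 => t _; rewrite lee_fin path_weight_at_ge0.
by apply: le_esum => z _; exact: off_weight_esum_le.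
Qed.

End Loops.

(** * Transience in dimension at least three *)

Section Transience.
Context (R : realType).

(** The power [s^(-1/4)], that is [|x|^(-1/2)] at [s = |x|^2]. Raising to the fourth power turns its
    inequalities into polynomial ones. *)
Definition inv_root4 (s : R) : R := (Num.sqrt (Num.sqrt s))^-1.

Lemma inv_root4_gt0 s : 0 < s -> 0 < inv_root4 s.
Proof. by move=> s0; rewrite invr_gt0 !sqrtr_gt0. Qed.

Lemma inv_root4_ge0 s : 0 <= inv_root4 s.
Proof. by rewrite invr_ge0 sqrtr_ge0. Qed.

Lemma inv_root4X s : 0 < s -> inv_root4 s ^+ 4 * s = 1.
Proof.
move=> s0; rewrite /inv_root4 exprVn (exprM _ 2 2) sqr_sqrtr ?sqrtr_ge0//.
by rewrite sqr_sqrtr ?ltW// mulVf ?lt0r_neq0.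
Qed.

(** This says [(1 + t)^(-1/4) <= 1 - t/4 + 3/16 t^2]. The Taylor coefficient is 5/32, so 3/16 leaves
    room for the remainder. *)
Lemma taylor_inv_root4 (t : R) : `|t| <= 8^-1 ->
  1 <= (1 + t) * (1 - t / 4 + 3 / 16 * t ^+ 2) ^+ 4.
Proof.
rewrite ler_norml => /andP[tl tu].
pose u := t / 4; have -> : t = 4 * u by rewrite /u; field.
have {tl tu} [ul uu] : - 32^-1 <= u /\ u <= 32^-1 by rewrite /u; split; lra.
rewrite -subr_ge0.
have -> : (1 + 4 * u) * (1 - 4 * u / 4 + 3 / 16 * (4 * u) ^+ 2) ^+ 4 - 1 = u ^+ 2 *
    (2 + u * (32 + u * (- 69 + u * (244 + u * (- 318 + u * (540 + u * (- 351 + u * 324))))))).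
  by field.
(* As [|u| <= 1/32], each bracket of the Horner form stays within 19 of its leading coefficient. The
   outermost is at least [2 - 35/32]. *)
have horner a x : - 600 <= x <= 600 -> a - 19 <= a + u * x <= a + 19.
  by move=> /andP[? ?]; apply/andP; split; nra.
have := horner (- 351) 324 ltac:(lra); move: (- 351 + u * 324) => x6 h6.
have := horner (540) x6 ltac:(lra); move: (540 + u * x6) => x5 h5.
have := horner (- 318) x5 ltac:(lra); move: (- 318 + u * x5) => x4 h4.
have := horner (244) x4 ltac:(lra); move: (244 + u * x4) => x3 h3.
have := horner (- 69) x3 ltac:(lra); move: (- 69 + u * x3) => x2 h2.
rewrite mulr_ge0 ?sqr_ge0//; clear h3 h4 h5 h6.
have h1 : - 35 <= 32 + u * x2 <= 35 by apply/andP; split; nra.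
by move: (32 + u * x2) h1 => x1 /andP[? ?]; nra.
Qed.

Lemma inv_root4_shift (s t : R) : 0 < s -> `|t| <= 8^-1 ->
  inv_root4 (s * (1 + t)) <= inv_root4 s * (1 - t / 4 + 3 / 16 * t ^+ 2).
Proof.
move=> s0 ht; have /andP[tl tu] : - 8^-1 <= t <= 8^-1 by rewrite -ler_norml.
have t0 : 0 < 1 + t by lra.
have P0 : 0 <= 1 - t / 4 + 3 / 16 * t ^+ 2.
  by have := sqr_ge0 t; lra.
rewrite -(@ler_pXn2r _ 4)// ?nnegrE ?mulr_ge0 ?inv_root4_ge0//.
rewrite exprMn; have := inv_root4X s0; have := inv_root4X (mulr_gt0 s0 t0).
set y1 := inv_root4 _ ^+ 4; set y0 := inv_root4 _ ^+ 4 => e1 e0.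
have y10 : 0 <= y1 by rewrite exprn_ge0// inv_root4_ge0.
have -> : y0 = y1 * (1 + t).
  by apply: (mulIf (lt0r_neq0 s0)); rewrite e0 -mulrA [(1 + t) * s]mulrC e1.
rewrite -[leRHS]mulrA; apply: ler_peMr => //; exact: taylor_inv_root4.
Qed.

(** With [a = 1 / (4 s)] this is [(1 + a)^4 (1 - 4 a) <= 1]. *)
Lemma inv_root4_pred (s : R) : 1 < s ->
  inv_root4 s * (1 + (4 * s)^-1) <= inv_root4 (s - 1).
Proof.
move=> s1; have s0 : 0 < s by lra.
have s10 : 0 < s - 1 by rewrite subr_gt0.
pose a := (4 * s)^-1; have a0 : 0 < a by rewrite invr_gt0; lra.
have sa : s * a = 4^-1 by rewrite /a; field; rewrite lt0r_neq0.
rewrite -(@ler_pXn2r _ 4)// ?nnegrE ?mulr_ge0 ?inv_root4_ge0//; last first.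
  by rewrite -/a; lra.
rewrite exprMn -/a; have := inv_root4X s0; have := inv_root4X s10.
set y1 := inv_root4 _ ^+ 4; set y0 := inv_root4 _ ^+ 4 => e1 e0.
have y00 : 0 <= y0 by rewrite exprn_ge0// inv_root4_ge0.
rewrite -(ler_pM2r s10) e1 -[leRHS]e0 -mulrA ler_wpM2l//.
have a14 : a < 4^-1 by nra.
have -> : s - 1 = s * (1 - 4 * a) by rewrite mulrBr mulr1 mulrCA sa; lra.
rewrite mulrCA ler_piMr ?(ltW s0)//.
have := sqr_ge0 (a ^+ 2); have := sqr_ge0 a; nra.
Qed.

Context (d : nat).
Hypothesis d3 : (2 < d)%N.
Implicit Types (x y z v : 'rV[int]_d).

Definition sqnorm v : R := \sum_(i < d) (v ord0 i)%:~R ^+ 2.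

Lemma sqnorm_ge0 v : 0 <= sqnorm v.
Proof. by apply: sumr_ge0 => i _; exact: sqr_ge0. Qed.

Lemma sqnormD_unitv v i b :
  sqnorm (v + unitv i b) = sqnorm v + 1 + (-1) ^+ b * 2 * (v ord0 i)%:~R.
Proof.
rewrite /sqnorm (bigD1 i)//= [in RHS](bigD1 i)//=.
rewrite [X in _ + X = _](eq_bigr (fun j => (v ord0 j)%:~R ^+ 2)); last first.
  by move=> j ji; rewrite mxE unitvE (negPf ji) addr0.
rewrite mxE unitvE eqxx intrD; case: b; rewrite ?expr0 ?expr1 ?mulrN1z; ring.
Qed.

(* |x|^(-1/2) is superharmonic on R^d for d >= 3; the shift 255 makes the steps
   small enough for the discrete inequality to hold everywhere, including at
   the origin. *)
Definition barrier z x : R := inv_root4 (255 + sqnorm (x - z)).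

(** With [s = 256 + |x - z|^2], the unit steps along axis [i] lead to the arguments [s (1 + t_i)]
    and [s (1 - t_i)]. Linear terms cancel in pairs and the [t_i^2] sum to at most [4 / s], so the
    average is at most [s^(-1/4) (1 + 3 / (4 d s))]. For [d >= 3] this is at most [(s - 1)^(-1/4)],
    the barrier at [x]. *)
Lemma barrier_superharmonic z x :
  step_prob R d * \sum_(v <- neighbors x) barrier z v <= barrier z x.
Proof.
have d0 : 0 < d%:R :> R by rewrite ltr0n; lia.
set s := 256 + sqnorm (x - z); have Q0 := sqnorm_ge0 (x - z).
have s1 : 256 <= s by rewrite lerDl.
have s0 : 0 < s by lra.
pose t i : R := 2 * ((x - z) ord0 i)%:~R / s.
have t2 : \sum_(i < d) t i ^+ 2 <= 4 / s.
  under eq_bigr => i _ do rewrite /t !exprMn.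
  rewrite -mulr_suml -mulr_sumr -/(sqnorm _) exprVn ler_pdivrMr ?exprn_gt0//.
  have -> : 4 / s * s ^+ 2 = 4 * s by field; rewrite lt0r_neq0.
  by rewrite /s; lra.
(* The shift enters here: [4 / s <= 4 / 256 = (1/8)^2]. *)
have ti i : `|t i| <= 8^-1.
  rewrite -(@ler_pXn2r _ 2)// ?nnegrE// real_normK ?num_real//.
  apply: (@le_trans _ _ (4 / s)).
    apply: le_trans t2; rewrite (bigD1 i)//= lerDl sumr_ge0// => j _.
    exact: sqr_ge0.
  by rewrite ler_pdivrMr//; lra.
rewrite big_neighbors.
apply: (@le_trans _ _ (step_prob R d *
    \sum_(i < d) inv_root4 s * (2 + 3 / 8 * t i ^+ 2))).
  apply: ler_wpM2l; first exact: step_prob_ge0.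
  apply: ler_sum => i _; rewrite /barrier.
  have st : s * t i = 2 * ((x - z) ord0 i)%:~R.
    by rewrite /t mulrC divfK// lt0r_neq0.
  have e b : 255 + sqnorm (x + unitv i b - z) = s * (1 + (-1) ^+ b * t i).
    rewrite [x + _ - z]addrAC sqnormD_unitv [RHS]mulrDr mulr1 [s * (_ * t i)]mulrCA st /s.
    ring.
  rewrite !e expr0 expr1 mul1r mulN1r.
  have tNi : `|- t i| <= 8^-1 by rewrite normrN.
  have := inv_root4_shift s0 (ti i); have := inv_root4_shift s0 tNi.
  rewrite sqrrN; lra.
rewrite -mulr_sumr big_split/= sumr_const card_ord -mulr_sumr.
have -> : barrier z x = inv_root4 (s - 1).
  by rewrite /barrier /s; congr inv_root4; lra.
apply: le_trans (inv_root4_pred _); last by lra.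
rewrite mulrCA; apply: ler_wpM2l; first exact: inv_root4_ge0.
rewrite /step_prob -mulr_natr mulrC ler_pdivrMr ?mulr_gt0//.
have e : (4 * s)^-1 = s^-1 / 4 by rewrite invfM mulrC.
have si : 0 < s^-1 by rewrite invr_gt0.
have d3' : 3 <= d%:R :> R by rewrite ler_nat.
rewrite e; nra.
Qed.

(** After its first step a loop is a first-passage path to [z] from a neighbor, so its total mass is
    at most the ratio of the barrier at a neighbor, [256^(-1/4)], to that at [z], [255^(-1/4)]. *)
Lemma loop_esum_le z :
  (\esum_(s in loop z) (step_prob R d ^+ size s)%:E <= (1024 / 1025)%:E)%E.
Proof.
apply: esum_le_seq => T uT hT.
have z1 : barrier z z = inv_root4 255.
  by rewrite /barrier subrr /sqnorm big1 ?addr0// => i _; rewrite mxE expr0n.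
have fz : 0 < barrier z z by rewrite z1 inv_root4_gt0.
rewrite -(ler_pM2r fz).
have hc t : t \in T -> t = z :: behead t /\ [/\ adjacent z (head z (behead t)) &
    first_passage (head z (behead t)) z (behead t)].
  by move=> /hT[s -> [? ?]].
pose T' := map behead T.
have uT' : uniq T'.
  by rewrite map_inj_in_uniq// => s t /hc[-> _] /hc[-> _] /= ->.
have -> : (\sum_(t <- T) step_prob R d ^+ size t) * barrier z z =
    step_prob R d * \sum_(t <- T') step_prob R d ^+ size t * barrier z z.
  rewrite big_map mulr_sumr mulr_suml !big_seq; apply: eq_bigr => t /hc[-> _] /=.
  by rewrite exprS mulrA.
have hT' t : t \in T' -> adjacent z (head z t) /\ first_passage (head z t) z t.
  by move=> /mapP[s /hc[_ [? ?]] ->].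
apply: (@le_trans _ _ (step_prob R d * \sum_(v <- neighbors z) barrier z v)).
  apply: ler_wpM2l; first exact: step_prob_ge0.
  apply: (@le_trans _ _ (\sum_(v <- neighbors z)
     \sum_(t <- T' | head z t == v) step_prob R d ^+ size t * barrier z z)).
    apply: sum_by_head => [t|t /hT'[/mem_neighbors//]].
    by rewrite mulr_ge0 ?exprn_ge0 ?step_prob_ge0// ltW.
  apply: ler_sum => v _; rewrite -big_filter.
  apply: (first_passage_sum_le (@step_prob_ge0 R d) (fun=> inv_root4_ge0 _)
    (fun x _ => barrier_superharmonic z x) (n := \max_(t <- T') size t)).
    exact: filter_uniq.
  move=> t; rewrite mem_filter => /andP[/eqP <-] tT; split; first by case: (hT' _ tT).
  exact: leq_bigmax_seq.
have -> : \sum_(v <- neighbors z) barrier z v =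
    \sum_(v <- neighbors z) inv_root4 256.
  rewrite !big_neighbors; apply: eq_bigr => i _; rewrite /barrier.
  have e b : 255 + sqnorm (z + unitv i b - z) = 256.
    rewrite [z + _ - z]addrAC subrr sqnormD_unitv mxE mulr0 /sqnorm big1 => [|j _].
      by ring.
    by rewrite mxE expr0n.
  by rewrite !e.
rewrite sum_neighbors_cst; last by lia.
have := @inv_root4_pred 256; rewrite z1 (_ : 256 - 1 = 255); last by lra.
rewrite -[(4 * 256)^-1](_ : 1024^-1 = _); last by congr (_^-1); lra.
move=> /(_ _); lra.
Qed.

Lemma loop_esum_lt1 : exists2 rho : R, 0 <= rho < 1 &
  forall z, (\esum_(s in loop z) (step_prob R d ^+ size s)%:E <= rho%:E)%E.
Proof. by exists (1024 / 1025); [apply/andP; split; lra|exact: loop_esum_le]. Qed.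

End Transience.

(** * From the probabilistic definitions to the partition function *)

Section EsumIntegral.
Context (R : realType).

(** Enumerating the indices by their codes turns the unordered sum into a series, which can be
    integrated termwise. *)
Lemma esum_pickle (I : countType) (S : set I) (a : I -> \bar R) :
  (forall i, (0 <= a i)%E) ->
  \esum_(i in S) a i = (\sum_(k <oo)
    (if pickle_inv k is Some i then if i \in S then a i else 0 else 0))%E.
Proof.
move=> a0; pose b k : \bar R := (if pickle_inv k is Some i then if i \in S then a i else 0 else 0)%E.
have b0 k : (0 <= b k)%E by rewrite /b; case: pickle_inv => // i; case: ifP.
rewrite -[RHS]/(\sum_(k <oo) b k)%E nneseries_esumT// (esumID (range (@pickle I)) setT)// setTI setTI.
rewrite [X in (_ + X)%E]esum1 ?adde0; last first.
  move=> k nk; rewrite /b; case: pickle_inv (@pickle_invK I k) => // i /= ik.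
  by case: nk; exists i.
rewrite (reindex_esum [set: I] (range (@pickle I)) (@pickle I)); last first.
  by apply: inj_bij => i j _ _; exact: (pcan_inj pickleK).
by rewrite esum_mkcond; apply: eq_esum => i _; rewrite /b pickleK_inv.
Qed.

Context (dT : measure_display) (T : measurableType dT) (mu : {measure set T -> \bar R}).
Context (I : countType) (S : set I) (f : I -> T -> \bar R).
Hypothesis mf : forall i, measurable_fun setT (f i).
Hypothesis f0 : forall i x, (0 <= f i x)%E.

Let g (k : nat) (x : T) : \bar R :=
  (if pickle_inv k is Some i then if i \in S then f i x else 0 else 0)%E.

Let g0 k x : (0 <= g k x)%E.
Proof. by rewrite /g; case: pickle_inv => // i; case: ifP. Qed.

Let mg k : measurable_fun setT (g k).
Proof.
by rewrite /g; case: (@pickle_inv I k) => [i|]//; case: (i \in S).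
Qed.

Lemma ge0_integral_esum :
  (\int[mu]_x (\esum_(i in S) f i x) = \esum_(i in S) (\int[mu]_x f i x))%E.
Proof.
rewrite [RHS]esum_pickle; last by move=> i; exact: integral_ge0.
rewrite (eq_integral (fun x => \sum_(k <oo) g k x)%E); last by move=> x _; rewrite esum_pickle.
rewrite integral_nneseries//.
apply: eq_eseriesr => k _; rewrite /g; case: (@pickle_inv I k) => [i|]; last exact: integral0.
by case: (i \in S) => //; exact: integral0.
Qed.

End EsumIntegral.

(** * The quenched weight as a sum over first-passage paths *)

Section WalkSum.
Context (R : realType) (d : nat) (walk : simple_random_walk R d).
Implicit Types (x y z : 'rV[int]_d) (t : seq 'rV[int]_d).
Local Notation S := (walk_pos walk).
Local Notation P := (walk_law walk).

Lemma esum_single (I : choiceType) (A : set I) (a : I -> \bar R) i :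
  A i -> (0 <= a i)%E -> (forall j, A j -> j != i -> a j = 0%E) ->
  \esum_(j in A) a j = a i.
Proof.
move=> Ai ai0 a0; rewrite -[RHS](esum_set1 ai0) esum_mkcond [RHS]esum_mkcond.
apply: eq_esum => j _; have [->|ji] := eqVneq j i.
  by rewrite !mem_set.
rewrite [RHS]ifF; last by apply/negP; rewrite inE => /= ij; rewrite ij eqxx in ji.
by case: ifPn => //; rewrite inE => Aj; exact: a0.
Qed.

(** The range includes the index [size t], where the default value of [nth] forces the walk to be at
    [y]. *)
Definition follows y t : set (walk_space walk) :=
  \bigcap_(k in [set` iota 0 (size t).+1]) (S k @^-1` [set nth y t k]).

Lemma followsP y t w : follows y t w <-> (forall k, (k <= size t)%N -> S k w = nth y t k).
Proof.
split => [h k kt|h k kt]; apply: h.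
  by change (k \in iota 0 (size t).+1); rewrite mem_iota.
by have : k \in iota 0 (size t).+1 := kt; rewrite mem_iota.
Qed.

Lemma measurable_follows y t : measurable (follows y t).
Proof.
by apply: fin_bigcap_measurable => [|k _]; [exact: finite_seq|exact: walk_measurable].
Qed.

(** A walk that hits [y] follows exactly one [t] avoiding [y], its positions before the hitting
    time; a walk that misses [y] follows none. *)
Lemma path_weight_esum (omega : 'rV[int]_d -> R) y w :
  (path_weight omega (S ^~ w) y)%:E = \esum_(t in [set t : seq 'rV[int]_d | y \notin t])
    (\1_(follows y t) w * expR (- \sum_(z <- t) omega z))%:E.
Proof.
rewrite /path_weight /hitting_time; case: pselect => [hk|nk]; last first.
  rewrite esum1// => t _; rewrite indicE memNset ?mul0r// => /followsP/(_ _ (leqnn _)).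
  by rewrite nth_default// => /eqP st; apply: nk; exists (size t).
case: ex_minnP => h /eqP Sh hmin; pose t0 := mkseq (S ^~ w) h.
have t0h : size t0 = h by rewrite size_mkseq.
have ft0 : follows y t0 w.
  apply/followsP => k; rewrite t0h leq_eqVlt => /predU1P[->|kh].
    by rewrite Sh nth_default// t0h.
  by rewrite nth_mkseq.
rewrite (esum_single (i := t0)).
- rewrite indicE mem_set// mul1r big_map -[h in iota _ h]subn0.
  by rewrite -/(index_iota 0 h) big_mkord.
- apply/mapP => -[k]; rewrite mem_iota => /= kh /eqP; rewrite eq_sym => /hmin.
  by rewrite leqNgt kh.
- by rewrite lee_fin mulr_ge0// expR_ge0.
- move=> t /= yt tt0; rewrite indicE memNset ?mul0r// => /followsP ft.
  have st : size t = h.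
    apply/eqP; rewrite eqn_leq hmin ?andbT; last first.
      by rewrite (ft _ (leqnn _)) nth_default.
    rewrite leqNgt; apply/negP => hlt; move/negP: yt; apply.
    by rewrite -Sh (ft _ (ltnW hlt)) mem_nth.
  move/eqP: tt0; apply; apply: (@eq_from_nth _ y); first by rewrite t0h.
  by rewrite st => k kh; rewrite nth_mkseq// ft// st ltnW.
Qed.

Lemma probability_setI1 (dT : measure_display) (T : measurableType dT)
    (Q : probability T R) (A B : set T) :
  measurable A -> measurable B -> Q A = 1%E -> Q (A `&` B) = Q B.
Proof.
move=> mA mB QA; rewrite [RHS](measureDI Q mB mA) [B `&` A]setIC.
rewrite [X in (X + _)%E](_ : _ = 0%E) ?add0e//; apply/eqP; rewrite -measure_le0.
have <- : Q (~` A) = 0%E by rewrite probability_setC// QA subee.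
by apply: le_measure => [|/=|x []//]; rewrite inE;
  [exact: measurableD|exact: measurableC].
Qed.

(** Given the almost sure start at [x], following [t] means making prescribed steps. These are
    independent, and a step to a non-adjacent site has probability 0. *)
Lemma probability_follows x y t : y \notin t ->
  P x (follows y t) = (if first_passage x y t then step_prob R d ^+ size t else 0)%:E.
Proof.
move=> yt; have [P0 Pstep Pind] := walk_srw walk x.
set step := fun k w => S k.+1 w - S k w in Pstep Pind.
have mS0 : measurable (S 0%N @^-1` [set x]) by exact: walk_measurable.
rewrite -(probability_setI1 mS0 (measurable_follows y t) P0).
have [hx|hx] := eqVneq (head y t) x; last first.
  rewrite /first_passage (negPf hx)/= -[RHS](measure0 (P x)); congr (P x _).
  apply/seteqP; split => // w [/= S0 /followsP /(_ 0%N (leq0n _))].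
  by rewrite S0 nth0 => xh; rewrite -xh eqxx in hx.
pose v k := nth y t k.+1 - nth y t k.
have -> : S 0%N @^-1` [set x] `&` follows y t =
    S 0%N @^-1` [set x] `&`
      \bigcap_(k in [set` iota 0 (size t)]) (step k @^-1` [set v k]).
  apply/seteqP; split => w [/= S0 h]; split => //.
    move=> k /=; rewrite mem_iota => /= kt; move/followsP: h => h.
    by rewrite /step /v !h// ltnW.
  apply/followsP; elim => [_|k IH kt]; first by rewrite S0 nth0.
  have := h k; rewrite /= mem_iota => /(_ kt) /eqP.
  by rewrite /step /v subr_eq IH ?(ltnW kt)// subrK => /eqP.
rewrite probability_setI1//; last first.
  apply: fin_bigcap_measurable => [|k _]; first exact: finite_seq.
  (* Only positions are assumed measurable, so the event on a step is decomposed over the countably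
     many values of the position before it. *)
  rewrite [X in measurable X](_ : _ =
    \bigcup_(u in [set: 'rV[int]_d]) (S k @^-1` [set u] `&` S k.+1 @^-1` [set u + v k])).
    apply: countable_bigcupT_measurable => [|u]; first exact: countableP.
    by apply: measurableI; exact: walk_measurable.
  apply/seteqP; split => [w /= <-|w [u _ [/= <- Sk]]].
    by exists (S k w) => //; split => //=; rewrite addrC subrK.
  by rewrite /step Sk addrC addKr.
rewrite Pind ?iota_uniq//.
have first_passageE : first_passage x y t = sorted (@adjacent d) (rcons t y).
  by rewrite /first_passage hx eqxx yt.
have nthE k : (k <= size t)%N -> nth y (rcons t y) k = nth y t k.
  rewrite nth_rcons; case: ltngtP => // ->; by rewrite nth_default.
rewrite first_passageE; case: ifPn => [/(sortedP y) srt|nsrt].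
  rewrite (eq_big_seq (fun=> (step_prob R d)%:E)) => [|k]; last first.
    rewrite mem_iota => /= kt; rewrite Pstep /v.
    have := srt k; rewrite size_rcons ltnS => /(_ kt).
    by rewrite !nthE ?(ltnW kt)// /adjacent => ->.
  by rewrite prodEFin big_const_seq count_predT size_iota iter_mulr mulr1.
have [k kt nadj] : exists2 k, (k < size t)%N & ~~ adjacent (nth y t k) (nth y t k.+1).
  move/(sortedP y): nsrt; rewrite -existsNE => -[k] /not_implyP[].
  rewrite size_rcons ltnS => kt; rewrite !nthE ?(ltnW kt)// => /negP nadj.
  by exists k.
rewrite (big_rem k) ?mem_iota//= Pstep /v.
by rewrite -[l1norm _ == 1]/(adjacent _ _) (negPf nadj) mul0e.
Qed.

Lemma travel_weight_esum (omega : 'rV[int]_d -> R) x y : (0 < d)%N ->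
  (forall z, 0 <= omega z) ->
  (travel_weight walk x y omega)%:E =
  \esum_(t in [set t | first_passage x y t])
    (step_prob R d ^+ size t * expR (- \sum_(z <- t) omega z))%:E.
Proof.
move=> d0 om0; rewrite /travel_weight unlock.
under eq_integral do rewrite path_weight_esum.
rewrite ge0_integral_esum; last 2 first.
- move=> t; apply/measurable_EFinP; apply: measurable_funM => //.
  by apply: measurable_indic; exact: measurable_follows.
- by move=> t w; rewrite lee_fin mulr_ge0// expR_ge0.
set E := \esum_(t in _) _; set F := \esum_(t in _) _.
have -> : E = F.
  rewrite /E /F (esum_mkcond [set t | first_passage x y t]) esum_mkcond.
  apply: eq_esum => t _.
  have -> : (\int[P x]_w (\1_(follows y t) w * expR (- \sum_(z <- t) omega z))%:E =
      (expR (- \sum_(z <- t) omega z))%:E * P x (follows y t))%E.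
    under eq_integral do rewrite mulrC EFinM.
    rewrite ge0_integralZl_EFin ?expR_ge0//.
      by rewrite integral_indic ?setIT//; exact: measurable_follows.
    by apply/measurable_EFinP/measurable_indic; exact: measurable_follows.
  have [yt|yt] := boolP (y \notin t).
    rewrite mem_set// probability_follows// -EFinM mulrC.
    have [fpt|nfpt] := boolP (first_passage x y t); first by rewrite mem_set.
    by rewrite memNset ?mul0r//; move/negP: nfpt.
  rewrite memNset; last by move/negP: yt.
  by rewrite memNset// => /and3P[_ /(negP yt)].
(* The sum is at most 1, so [fine] loses nothing. *)
rewrite fineK// ge0_fin_numE; last first.
  by apply: esum_ge0 => t _; rewrite lee_fin mulr_ge0 ?exprn_ge0 ?step_prob_ge0 ?expR_ge0.
apply: (@le_lt_trans _ _ 1%E); last exact: ltry.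
apply: le_trans (esum_step_prob_le1 R x y d0); apply: le_esum => t _.
rewrite lee_fin ler_piMr ?exprn_ge0 ?step_prob_ge0// -expR0 ler_expR oppr_le0.
exact: sumr_ge0.
Qed.

End WalkSum.

(** * Averaging over the Bernoulli potential *)

Section PotentialAverage.
Context (R : realType) (dO : measure_display) (O : measurableType dO).
Context (Q : probability O R) (d : nat) (omega : 'rV[int]_d -> {mfun O >-> R}) (r : R).
Hypothesis omega_law : is_bernoulli_law Q r omega.
Implicit Types (z : 'rV[int]_d) (L : seq 'rV[int]_d) (n : 'rV[int]_d -> nat).

Let weight n L (o : O) : \bar R := (\prod_(z <- L) expR (- ((n z)%:R * omega z o)))%:E.

Let weight_ge0 n L o : (0 <= weight n L o)%E.
Proof. by rewrite lee_fin prodr_ge0// => z _; rewrite expR_ge0. Qed.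

Let measurable_weight n L D : measurable_fun D (weight n L).
Proof.
apply/measurable_EFinP; apply: measurable_prod => z _.
apply: (measurable_funS measurableT) => //.
apply: measurableT_comp; first exact: measurable_expR.
by apply: measurable_funN; exact: measurable_funM.
Qed.

Let event L (A : 'rV[int]_d -> set R) : set O :=
  \bigcap_(z in [set` L]) (omega z @^-1` A z).

Let measurable_event L A : (forall z, measurable (A z)) -> measurable (event L A).
Proof.
move=> mA; apply: fin_bigcap_measurable => [|z _]; first exact: finite_seq.
by rewrite -[_ @^-1` _]setTI; apply: measurable_funP.
Qed.

(** The event on [L1] is there for the induction on [L2]: conditioning on the value at [z] moves [z]
    from the integrand into the event, and independence is applied once [L2] is empty. *)
Lemma integral_weight_event n L1 L2 (A : 'rV[int]_d -> set R) :
  uniq (L2 ++ L1) -> (forall z, measurable (A z)) ->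
  (\int[Q]_(o in event L1 A) weight n L2 o =
   (\prod_(z <- L1) Q (omega z @^-1` A z)) *
   (\prod_(z <- L2) visit_factor r (n z))%:E)%E.
Proof.
have [Q0 Q1 Qind] := omega_law.
elim: L2 L1 A => [|z L2 IH] L1 A /= uL mA.
  rewrite big_nil mule1 -Qind//.
  under eq_integral do rewrite /weight big_nil.
  by rewrite integral_cst ?mul1e//; exact: measurable_event.
pose B (b : R) u := if u == z then [set b] else A u.
have mB b u : measurable (B b u) by rewrite /B; case: ifP.
have zL1 : z \notin L1.
  by move: uL => /andP[]; rewrite mem_cat negb_or => /andP[].
have BE b : event (z :: L1) (B b) = event L1 A `&` omega z @^-1` [set b].
  apply/seteqP; split => [w h|w [h hz]].
    split; last by have := h z; rewrite /B /= inE !eqxx => /(_ isT).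
    move=> u /= uL1; have := h u; rewrite /= inE uL1 orbT => /(_ isT).
    by rewrite /B; case: eqP => // uz; rewrite -uz uL1 in zL1.
  move=> u; rewrite /= inE /B => /orP[/eqP ->|uL1]; first by rewrite eqxx.
  by case: eqP => [uz|_]; [rewrite -uz uL1 in zL1|exact: h].
have IHb b : (\int[Q]_(o in event (z :: L1) (B b)) weight n L2 o =
    Q (omega z @^-1` [set b]) * ((\prod_(z <- L1) Q (omega z @^-1` A z)) *
    (\prod_(z <- L2) visit_factor r (n z))%:E))%E.
  rewrite IH//; last first.
    by rewrite -cat1s uniq_catCA.
  rewrite big_cons {1}/B eqxx muleA; congr (_ * _ * _)%E.
  by apply: eq_big_seq => u uL1; rewrite /B; case: eqP => // uz; rewrite -uz uL1 in zL1.
have mz b : measurable (omega z @^-1` [set b]).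
  by rewrite -[_ @^-1` _]setTI; apply: measurable_funP.
(* The null set where the potential at [z] is neither 0 nor 1. *)
pose N := ~` (omega z @^-1` [set 0] `|` omega z @^-1` [set 1]).
have disj : [disjoint omega z @^-1` [set 0] & omega z @^-1` [set 1]].
  apply/disj_setPS => o [/= -> /eqP]; by rewrite eq_sym oner_eq0.
have mN : measurable N by apply: measurableC; exact: measurableU.
have QN : Q N = 0%E.
  rewrite probability_setC; last exact: measurableU.
  have QU : Q (omega z @^-1` [set 0] `|` omega z @^-1` [set 1]) =
      (Q (omega z @^-1` [set 0%R]) + Q (omega z @^-1` [set 1%R]))%E.
    by apply: measureU; [exact: mz|exact: mz|exact/disj_set2P].
  have r1 : (r%:E + (1 - r)%:E = 1 :> \bar R)%E by rewrite -EFinD addrC subrK.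
  by rewrite QU Q0 Q1 r1 subee.
rewrite (ge0_negligible_integral mN)//; last exact: measurable_event.
have -> : event L1 A `\` N = event (z :: L1) (B 0) `|` event (z :: L1) (B 1).
  by rewrite setDE setCK setIUr !BE.
rewrite ge0_integral_setU//; last 3 first.
- exact: measurable_event.
- exact: measurable_event.
- rewrite !BE; apply/disj_setPS => o [[_ h0] [_ h1]].
  by move/disj_setPS : disj => /(_ o); apply.
have wE b o : event (z :: L1) (B b) o ->
    weight n (z :: L2) o = ((expR (- ((n z)%:R * b)))%:E * weight n L2 o)%E.
  by rewrite BE => -[_ /= ob]; rewrite /weight big_cons EFinM ob.
have intE b : (\int[Q]_(o in event (z :: L1) (B b)) weight n (z :: L2) o =
    (expR (- ((n z)%:R * b)))%:E * \int[Q]_(o in event (z :: L1) (B b)) weight n L2 o)%E.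
  rewrite -ge0_integralZl_EFin ?expR_ge0//; last exact: measurable_event.
  by apply: eq_integral => o; rewrite inE => /wE.
rewrite !intE !IHb Q0 Q1 mulr0 oppr0 expR0 mulr1 mul1e big_cons.
(* Both weights are nonnegative because they are probabilities. *)
have r0 : 0 <= r by rewrite -lee_fin -(Q0 z).
have r1 : 0 <= 1 - r by rewrite -lee_fin -(Q1 z).
set X := (\prod_(_ <- L1) _)%E; set Y := \prod_(_ <- L2) _.
rewrite EFinM [in RHS]muleCA [((expR _)%:E * _)%E]muleA -EFinM.
rewrite -ge0_muleDl ?lee_fin ?mulr_ge0 ?expR_ge0//.
by rewrite -EFinD [_ * (1 - r)]mulrC.
Qed.

Lemma integral_exp_visits t :
  (\int[Q]_o (expR (- \sum_(z <- t) omega z o))%:E = (path_factor r t)%:E)%E.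
Proof.
have := @integral_weight_event (fun z => count_mem z t) [::] (undup t) (fun=> setT).
rewrite cats0 undup_uniq big_nil mul1e => <-//.
have -> : event [::] (fun=> setT) = setT by apply/seteqP; split.
apply: eq_integral => o _; rewrite expR_sum_visits; congr EFin.
by apply: eq_bigr => z _; rewrite -expRM_natl mulrN.
Qed.

End PotentialAverage.


(** Tonelli's theorem exchanges the potential average with the path sum; each path then contributes
    its [path_factor]. *)
Lemma annealed_costE (R : realType) (d : nat) (walk : simple_random_walk R d)
    (pot : bernoulli_potential R d) (r : R) (x y : 'rV[int]_d) :
  (0 < d)%N -> 0 <= r <= 1 ->
  annealed_cost walk pot r x y = - ln (fine (partition_function r x y)).
Proof.
move=> d0 r01; rewrite /annealed_cost unlock; congr (- ln (fine _)).
have om0 := pot_ge0 (b := pot).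
have mexp (t : seq 'rV[int]_d) : measurable_fun setT
    (fun o : pot_space pot => expR (- \sum_(z <- t) pot_val pot z o)).
  apply: measurableT_comp; first exact: measurable_expR.
  by apply: measurable_funN; exact: measurable_sum.
under eq_integral do rewrite travel_weight_esum//.
rewrite ge0_integral_esum; last 2 first.
- move=> t; apply/measurable_EFinP; apply: measurable_funM => //.
- by move=> t o; rewrite lee_fin mulr_ge0 ?exprn_ge0 ?step_prob_ge0 ?expR_ge0.
apply: eq_esum => t _; under eq_integral do rewrite EFinM.
rewrite ge0_integralZl_EFin ?exprn_ge0 ?step_prob_ge0//; last exact/measurable_EFinP.
by rewrite (integral_exp_visits (pot_bernoulli pot r01)) -EFinM.
Qed.

(** * Comparison of the costs and of their limits *)

Section NormExtension.
Context (R : realType) (d : nat).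
Implicit Types (N : 'rV[R]_d -> R) (u v w x : 'rV[R]_d) (z : 'rV[int]_d).

Lemma is_norm0 N : is_norm N -> N 0 = 0.
Proof. by case=> _ NZ _; rewrite -(scale0r (0 : 'rV[R]_d)) NZ normr0 mul0r. Qed.

Lemma is_normN N v : is_norm N -> N (- v) = N v.
Proof. by case=> _ NZ _; rewrite -scaleN1r NZ normrN1 mul1r. Qed.

Lemma is_norm_ge0 N v : is_norm N -> 0 <= N v.
Proof.
move=> nN; have [ND _ _] := nN.
by have := ND v (- v); rewrite subrr is_norm0// is_normN//; lra.
Qed.

Lemma is_norm_le_l1norm N v : is_norm N ->
  N v <= (\sum_(i < d) N (delta_mx ord0 i)) * l1norm v.
Proof.
move=> nN; have [ND NZ _] := nN; rewrite {1}(row_sum_delta v) mulr_sumr.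
apply: (@le_trans _ _ (\sum_(i < d) `|v ord0 i| * N (delta_mx ord0 i))).
  apply: (big_ind2 (fun a b => N a <= b)) => [|a b a' b' ab ab'|i _].
  - by rewrite is_norm0.
  - by apply: le_trans (ND _ _) _; rewrite lerD.
  - by rewrite NZ.
apply: ler_sum => i _; rewrite mulrC ler_wpM2r// (bigD1 i)//= lerDl.
by apply: sumr_ge0 => j _; exact: is_norm_ge0.
Qed.

Lemma l1norm_embed z : l1norm (embed R z) = (sitenorm z)%:R.
Proof.
rewrite /l1norm /sitenorm natr_sum; apply: eq_bigr => i _.
by rewrite mxE -intr_norm -abszE.
Qed.

Lemma l1normD u v : l1norm (u + v) <= l1norm u + l1norm v.
Proof.
by rewrite /l1norm -big_split; apply: ler_sum => i _; rewrite mxE ler_normD.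
Qed.

Lemma l1normN u : l1norm (- u) = l1norm u.
Proof. by apply: eq_bigr => i _; rewrite mxE normrN. Qed.

Lemma l1norm_gt0 u : u != 0 -> 0 < l1norm u.
Proof.
move=> u0; rewrite lt_def sumr_ge0// andbT; apply: contra u0 => /eqP l0.
apply/eqP/rowP => i; rewrite mxE; apply/eqP; rewrite -normr_eq0.
by move/eqP: l0; rewrite psumr_eq0// => /allP/(_ i); rewrite mem_index_enum => /(_ isT).
Qed.

Lemma le0_of_natmul_bounded (a D : R) : (forall n, n%:R * a <= D) -> a <= 0.
Proof.
move=> h; rewrite leNgt; apply/negP => a0.
have D0 : 0 <= D by have := h 0%N; rewrite mul0r.
have := h (Num.bound (D / a)); rewrite leNgt -ltr_pdivrMr// => /negP; apply.
by apply: archi_boundP; rewrite divr_ge0// ltW.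
Qed.

(** Rounding [n x] to a lattice point costs at most [d] in the l1-norm, hence a bounded amount in
    each norm. So [n] times the excess of the left side over the right is bounded in [n]. *)
Lemma is_norm_le_extend N1 N2 (c : R) : is_norm N1 -> is_norm N2 ->
  (forall z, N1 (embed R z) <= N2 (embed R z) + c * l1norm (embed R z)) ->
  forall x, N1 x <= N2 x + c * l1norm x.
Proof.
move=> n1 n2 h x; have [N1D N1Z _] := n1; have [N2D N2Z _] := n2.
pose M1 := \sum_(i < d) N1 (delta_mx ord0 i).
pose M2 := \sum_(i < d) N2 (delta_mx ord0 i).
have M10 : 0 <= M1 by apply: sumr_ge0 => i _; exact: is_norm_ge0.
have M20 : 0 <= M2 by apply: sumr_ge0 => i _; exact: is_norm_ge0.
rewrite -subr_le0; apply: (@le0_of_natmul_bounded _ ((M1 + M2 + `|c|) * d%:R)) => n.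
pose z : 'rV[int]_d := \row_i Num.floor (n%:R * x ord0 i).
pose w := n%:R *: x - embed R z.
have wd : l1norm w <= d%:R.
  rewrite -[d in d%:R]card_ord -sumr_const; apply: ler_sum => i _.
  rewrite !mxE; have := floor_itv (n%:R * x ord0 i); rewrite intrD => /andP[? ?].
  by rewrite ger0_norm; lra.
have e1 : n%:R * N1 x <= N1 (embed R z) + M1 * d%:R.
  have -> : n%:R * N1 x = N1 (embed R z + w).
    by rewrite /w addrC subrK N1Z ger0_norm.
  apply: le_trans (N1D _ _) _; rewrite lerD2l.
  by apply: le_trans (is_norm_le_l1norm _ n1) _; rewrite ler_wpM2l.
have e2 : N2 (embed R z) <= n%:R * N2 x + M2 * d%:R.
  have -> : embed R z = n%:R *: x + - w by rewrite /w opprB addrC subrK.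
  apply: le_trans (N2D _ _) _; rewrite is_normN// N2Z ger0_norm// lerD2l.
  by apply: le_trans (is_norm_le_l1norm _ n2) _; rewrite ler_wpM2l.
have nx : l1norm (n%:R *: x) = n%:R * l1norm x.
  by rewrite /l1norm mulr_sumr; apply: eq_bigr => i _; rewrite mxE normrM ger0_norm.
have e3 : `|l1norm (embed R z) - n%:R * l1norm x| <= d%:R.
  rewrite -nx ler_norml; apply/andP; split.
    have := l1normD (embed R z) w; rewrite /w addrC subrK -/w; lra.
  have := l1normD (n%:R *: x) (- w); rewrite l1normN /w opprB addrC subrK -/w; lra.
(* The constant [c] may be negative, hence the absolute value in the error. *)
have e4 : c * l1norm (embed R z) <= c * (n%:R * l1norm x) + `|c| * d%:R.
  rewrite -lerBlDl -mulrBr; apply: le_trans (ler_norm _) _.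
  by rewrite normrM ler_wpM2l.
have := h z; lra.
Qed.

End NormExtension.

(** * From partition functions to costs and Lyapunov exponents *)

Section LyapunovComparison.
Context (R : realType) (d : nat).
Hypothesis d0 : (0 < d)%N.
Context (walk : simple_random_walk R d) (pot : bernoulli_potential R d).

Lemma sitenormMn (z : 'rV[int]_d) n : sitenorm (z *+ n) = (n * sitenorm z)%N.
Proof.
rewrite /sitenorm big_distrr; apply: eq_bigr => i _ /=.
by rewrite mulmxnE -mulr_natr abszM natz mulnC.
Qed.

Lemma lyapunov_le_of_cost p q (f g : 'rV[R]_d -> R) (C : R) :
  annealed_lyapunov walk pot p f -> annealed_lyapunov walk pot q g ->
  (forall z : 'rV[int]_d, z != 0 -> annealed_cost walk pot p 0 z <=
     annealed_cost walk pot q 0 z + C * (sitenorm z)%:R) ->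
  forall x, f x <= g x + C * l1norm x.
Proof.
move=> [nf cf _] [ng cg _] h; apply: is_norm_le_extend => // z.
have [->|z0] := eqVneq z 0.
  have -> : embed R (0 : 'rV[int]_d) = 0 by apply/rowP => i; rewrite !mxE.
  have -> : l1norm (0 : 'rV[R]_d) = 0 by apply: big1 => i _; rewrite mxE normr0.
  by rewrite !is_norm0// mulr0 addr0.
have cgC : (fun n => annealed_cost walk pot q 0 (z *+ n) / n%:R + C * l1norm (embed R z))
    @ \oo --> g (embed R z) + C * l1norm (embed R z).
  by apply: cvgD; [exact: cg|exact: cvg_cst].
apply: ler_cvg_to (cf z) cgC _; exists 1%N => // n /= n1.
have n0 : 0 < n%:R :> R by rewrite ltr0n.
rewrite ler_pdivrMr// mulrDl divfK ?lt0r_neq0// l1norm_embed -mulrA -natrM mulnC -sitenormMn.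
apply: h; rewrite -sitenorm_eq0 sitenormMn muln_eq0 negb_or sitenorm_eq0 z0 andbT.
by rewrite -lt0n.
Qed.

Lemma partition_function_gt0 r (x y : 'rV[int]_d) : 0 <= r <= 1 ->
  0 < fine (partition_function r x y :> \bar R).
Proof.
move=> r01; rewrite -lte_fin fineK ?partition_function_fin//.
apply: lt_le_trans (partition_function_ge x y r01).
by rewrite lte_fin exprn_gt0// mulr_gt0 ?expR_gt0 ?step_prob_gt0.
Qed.

Lemma cost_le p q (a : R) (x y : 'rV[int]_d) : 0 <= p <= 1 -> 0 <= q <= 1 ->
  ((expR (- a))%:E * partition_function q x y <= partition_function p x y)%E ->
  annealed_cost walk pot p x y <= annealed_cost walk pot q x y + a.
Proof.
move=> p01 q01; rewrite !annealed_costE//.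
have Zp := partition_function_gt0 x y p01; have Zq := partition_function_gt0 x y q01.
rewrite -(fineK (partition_function_fin x y d0 p01)).
rewrite -(fineK (partition_function_fin x y d0 q01)) -EFinM lee_fin => h.
have : ln (expR (- a) * fine (partition_function q x y)) <=
    ln (fine (partition_function p x y)).
  by rewrite ler_ln ?posrE ?mulr_gt0 ?expR_gt0.
by rewrite lnM ?posrE ?expR_gt0// expRK; lra.
Qed.

(** The factor of [partition_function_lower] is moved to the other side, so [cost_le] applies with
    the parameters exchanged and a negative [a]. *)
Lemma cost_lower p q (z : 'rV[int]_d) : 0 < p -> p < q -> q < 1 ->
  annealed_cost walk pot q 0 z <= annealed_cost walk pot p 0 z +
    (- ((1 - expR (- 1)) * (q - p))) * (sitenorm z)%:R.
Proof.
move=> p0 pq q1; apply: cost_le; [lra|lra|].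
set k := _ * (q - p); rewrite mulNr opprK.
have := partition_function_lower 0 z p0 pq q1; rewrite subr0 -/k mulNr.
move=> /(lee_wpmul2l (x := (expR (k * (sitenorm z)%:R))%:E)).
rewrite lee_fin expR_ge0 => /(_ isT); rewrite muleA -EFinM.
by rewrite expRxMexpNx_1 mul1e.
Qed.

End LyapunovComparison.

(** * Upper bounds for cost differences *)

Section UpperBounds.
Context (R : realType) (d : nat).
Hypothesis d0 : (0 < d)%N.

(** Every factor for [q] is at most [q / p] times that for [p], so [g = 1] and [k = ln q - ln p]
    fit; [M] is the mean range bound. *)
Lemma cost_upper_log (q0 : R) : 0 < q0 < 1 -> exists2 C : R, 0 < C &
  forall (walk : simple_random_walk R d) (pot : bernoulli_potential R d)
    p q (z : 'rV[int]_d), 0 < p -> p < q -> q <= q0 -> z != 0 ->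
  annealed_cost walk pot p 0 z <= annealed_cost walk pot q 0 z +
    C * (ln q - ln p) * (sitenorm z)%:R.
Proof.
move=> q01; have [K K0 hK] := mean_range_le d0 q01.
exists K => // walk pot p q z p0 pq qq0 zn0; apply: cost_le; [done|lra|lra|].
have := hK q 0 z; rewrite subr0 eq_sym => h.
rewrite [K * _]mulrC -mulrA; apply: (@partition_function_upper _ _ _ _ _ _ (fun=> 1)) => //.
- lra.
- lra.
- by rewrite subr_ge0 ler_ln ?posrE; lra.
- by rewrite mulr_ge0// ltW.
- move=> l _; rewrite mulr1 opprB expRD expRN !lnK ?posrE//; last lra.
  rewrite mulrA ler_pdivrMr; last lra.
  have : 0 <= expR (- l%:R) * (q - p) by rewrite mulr_ge0 ?expR_ge0// subr_ge0 ltW.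
  by rewrite /visit_factor; lra.
- under eq_esum do rewrite big_const_seq count_predT iter_addr_0.
  by apply: h => //; lra.
Qed.

Lemma cost_upper_double (q0 : R) : (2 < d)%N -> 0 < q0 < 1 -> exists2 C : R, 0 < C &
  forall (walk : simple_random_walk R d) (pot : bernoulli_potential R d)
    p q (z : 'rV[int]_d), 0 < p -> p < q -> q <= 2 * p -> q <= q0 -> z != 0 ->
  annealed_cost walk pot p 0 z <= annealed_cost walk pot q 0 z +
    C * (q - p) * (sitenorm z)%:R.
Proof.
move=> d3 q01; have [K K0 hK] := mean_range_le d0 q01.
have [rho rho01 hrho] := loop_esum_lt1 R d3.
pose G : R := expR 1 / (1 - rho).
have G0 : 0 < G by rewrite divr_gt0 ?expR_gt0//; lra.
exists (2 * G * K); first by rewrite mulr_gt0// mulr_gt0.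
move=> walk pot p q z p0 pq q2p qq0 zn0; apply: cost_le; [done|lra|lra|].
have qq01 : 0 < q <= q0 by lra.
have := hK q 0 z qq01; rewrite subr0 eq_sym => /(_ zn0) h.
have -> : 2 * G * K * (q - p) * (sitenorm z)%:R =
    2 * (q - p) * (G * (K * (sitenorm z)%:R)) by ring.
have q01' : 0 <= q <= 1 by lra.
apply: (@partition_function_upper _ _ _ _ _ _ (fun l => (visit_factor q l)^-1)) => //.
- lra.
- lra.
- lra.
- by rewrite mulr_ge0 ?(ltW G0)// mulr_ge0 ?(ltW K0).
- by move=> l; rewrite invr_ge0 ltW// visit_factor_gt0.
(* With [a] and [b] the factors for [q] and [p], [a <= 2 b] gives [b s >= a s / 2 = q - p >= a - b],
   so [a <= b (1 + s) <= b e^s]. *)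
- move=> l _; have a0 := visit_factor_gt0 l q01'.
  set a := visit_factor q l in a0 *; set b := visit_factor p l.
  have e0 := expR_ge0 (- l%:R : R); have e1 := @expRN_nat_le1 R l.
  have ab : a - b <= q - p.
    have : 0 <= expR (- l%:R) * (q - p) by rewrite mulr_ge0// subr_ge0 ltW.
    by rewrite /a /b /visit_factor; lra.
  have ba : b <= a by exact/visit_factor_mono/ltW.
  have a2b : a <= 2 * b.
    have : 0 <= (2 * p - q) * (1 - expR (- l%:R)) by rewrite mulr_ge0//; lra.
    by rewrite /a /b /visit_factor; lra.
  rewrite expRN ler_pdivrMr ?expR_gt0//.
  set s := 2 * (q - p) * a^-1.
  have as_ : a * s = 2 * (q - p) by rewrite /s mulrC divfK ?lt0r_neq0.
  have es := expR_ge1Dx s.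
  apply: (@le_trans _ _ (b * (1 + s))); last by rewrite ler_wpM2l//; lra.
  by rewrite -(ler_pM2l a0); nra.
- apply: le_trans (inverse_factor_sum_le 0 z d0 q01' rho01 hrho) _.
  rewrite -/G [(G * _)%:E]EFinM -muleA; apply: lee_wpmul2l => //.
  by rewrite lee_fin ltW.
Qed.

End UpperBounds.

Theorem theorem1p3 (R : realType) (d : nat) (hd : (1 <= d)%N) :
  (forall (walk : simple_random_walk R d) (pot : bernoulli_potential R d)
      (beta : R -> 'rV[R]_d -> R),
    (forall r : R, 0 < r < 1 -> annealed_lyapunov walk pot r (beta r)) ->
    forall p q : R, 0 < p -> p < q -> q < 1 ->
      (((1 - expR (-1)) * (q - p))%:E <=
         ereal_inf (slope_set (beta p) (beta q)))%E)
  /\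
  (forall q0 : R, 0 < q0 -> q0 < 1 ->
    (exists C : R, 0 < C /\
      forall (walk : simple_random_walk R d) (pot : bernoulli_potential R d)
        (beta : R -> 'rV[R]_d -> R),
      (forall r : R, 0 < r < 1 -> annealed_lyapunov walk pot r (beta r)) ->
      forall p q : R, 0 < p -> p < q -> q <= q0 ->
        (ereal_sup (slope_set (beta p) (beta q)) <= (C * (ln q - ln p))%:E)%E)
    /\
    ((3 <= d)%N ->
     exists C : R, 0 < C /\
      forall (walk : simple_random_walk R d) (pot : bernoulli_potential R d)
        (beta : R -> 'rV[R]_d -> R),
      (forall r : R, 0 < r < 1 -> annealed_lyapunov walk pot r (beta r)) ->
      forall p q : R, 0 < p -> p < q -> q <= q0 ->
        (ereal_sup (slope_set (beta p) (beta q)) <= (C * (q - p))%:E)%E)).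
Proof.
have sup_le f g (c : R) : (forall x, f x <= g x + c * l1norm x) ->
    (ereal_sup (@slope_set R d f g) <= c%:E)%E.
  move=> h; apply: ge_ereal_sup => _ [x /= x0 <-]; rewrite lee_fin.
  by rewrite ler_pdivrMr ?l1norm_gt0// lerBlDl.
split=> [walk pot beta hbeta p q p0 pq q1|q0 q00 q01].
  apply: le_ereal_inf_tmp => _ [x /= x0 <-]; rewrite lee_fin.
  rewrite ler_pdivlMr ?l1norm_gt0//.
  have p01 : 0 < p < 1 by lra.
  have qq01 : 0 < q < 1 by lra.
  have := lyapunov_le_of_cost (hbeta _ qq01) (hbeta _ p01)
    (fun z _ => cost_lower hd walk pot z p0 pq q1) x.
  lra.
have q0' : 0 < q0 < 1 by rewrite q00.
split=> [|d3].
  have [C C0 hC] := cost_upper_log hd q0'.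
  exists C; split=> // walk pot beta hbeta p q p0 pq qq0; apply: sup_le.
  apply: lyapunov_le_of_cost; [by apply: hbeta; lra|by apply: hbeta; lra|].
  by move=> z; exact: hC.
have [C C0 hC] := cost_upper_double hd d3 q0'.
exists C; split=> // walk pot beta hbeta p q p0 pq qq0; apply: sup_le.
(* The doubling bound is chained through [p, 2 p, 4 p, ...] until [q] is within a factor 2. The
   increments telescope to [q - p], so the constant does not depend on the number [m] of
   doublings. *)
have [m] : exists m, q <= 2 ^+ m * p.
  exists (Num.bound (q / p)); rewrite -ler_pdivrMr// ltW//.
  apply: lt_le_trans (archi_boundP _) _; first by rewrite divr_ge0//; lra.
  by rewrite -natrX ler_nat ltnW// ltn_expl.
elim: m p p0 pq => [|m IH] p p0 pq; first by rewrite expr0 mul1r; lra.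
move=> q2m x; have step p' : p < p' -> p' <= 2 * p -> p' <= q0 ->
    beta p x <= beta p' x + C * (p' - p) * l1norm x.
  move=> pp' p'2 p'q; apply: lyapunov_le_of_cost.
  - by apply: hbeta; lra.
  - by apply: hbeta; lra.
  - by move=> z z0; apply: hC.
have [q2|q2] := leP q (2 * p); first exact: step.
have := IH (2 * p) _ q2; rewrite mulrA -exprSr => /(_ _ q2m x).
have := step (2 * p); lra.
Qed.
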